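(* Let $(G,\eta\colon M\otimes G\to G)$ be an initial algebra of the endofunctor $M\otimes-$ on $\mathsf{SquaMS}$ (so $\eta$ is an isomorphism), let $Q=C(G)$ be the Cauchy completion, and let $\gamma\colon Q\to M\otimes Q$ be the composite of $C(\eta^{-1})\colon C(G)\to C(M\otimes G)$ with the canonical isometric isomorphism $C(M\otimes G)\cong M\otimes C(G)$ (sending the class of a Cauchy sequence $(m_k\otimes x_k)_k$ to $m^*\otimes(x_{k_j})_j$, where $m^*$ is an index occurring infinitely often and $(x_{k_j})$ the corresponding subsequence). Then $(Q,\gamma)$ is a final coalgebra for $M\otimes-\colon\mathsf{SquaMS}\to\mathsf{SquaMS}$.
   Context: Let $M_0=\{(r,s)\in[0,1]^2: r\in\{0,1\}\text{ or } s\in\{0,1\}\}$. A square metric space is a pair $(X,S_X)$ where $X$ is a metric space with all distances at most $2$ and $S_X\colon M_0\to X$ is injective, such that (sq1) for $i\in\{0,1\}$, $r,s\in[0,1]$: $d_X(S_X(i,r),S_X(i,s))=|s-r|$ and $d_X(S_X(r,i),S_X(s,i))=|s-r|$; (sq2) $d_X(S_X(r,s),S_X(t,u))\ge |r-t|+|s-u|$ for all $(r,s),(t,u)\in M_0$. $\mathsf{SquaMS}$ has these as objects and short maps $f$ with $f\circ S_X=S_Y$ as morphisms. Let $N=\{0,1,2\}^2$, $M=N\setminus\{(1,1)\}$, viewed also as points of $\mathbb{R}^2$. For $X$ in $\mathsf{SquaMS}$, $M\otimes X=(M\times X)/\!\sim$ where $\sim$ is the equivalence relation generated by $(m,S_X(p))\sim(n,S_X(q))$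 whenever $m,n$ differ by exactly $1$ in exactly one coordinate and $(m+p)/3=(n+q)/3$; $m\otimes x$ denotes the class of $(m,x)$. With $d((a,u),(b,v))=\frac13 d_X(u,v)$ if $a=b$ and $2$ otherwise on $M\times X$, the metric of $M\otimes X$ is the quotient metric (infimum over finite chains of the sum of consecutive distances, counting $\sim$-related consecutive pairs as $0$). $S_{M\otimes X}(p)=m\otimes S_X(3p-m)$ for any $m\in M$ with $p\in(m+[0,1]^2)/3$; $(M\otimes f)(m\otimes x)=m\otimes f(x)$. Cauchy completion $C(X)$ has $S_{C(X)}(p)$ the class of the constant sequence $S_X(p)$. An algebra for $F$ is $(A,a\colon FA\to A)$; a coalgebra is $(A,a\colon A\to FA)$; a coalgebra morphism $h\colon(A,a)\to(B,b)$ satisfies $b\circ h=Fh\circ a$; a final coalgebra admits a unique coalgebra morphism from every coalgebra. *)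

(* Defs.v *)
From Stdlib Require Import Reals Lra ClassicalEpsilon.
From Stdlib Require Import Relations.Relation_Operators.
From Coquelicot Require Import Coquelicot.
Set Implicit Arguments.
Open Scope R_scope.

(** * Raw structures: a carrier, a distance, and the map S (given on all of
    R x R, only its values on M_0 matter). *)
Record SqStr := { car :> Type; dist : car -> car -> R; sqm : R -> R -> car }.
Arguments dist {s} _ _.
Arguments sqm s _ _ : assert.

Definition inM0 (r s : R) : Prop :=
  0 <= r <= 1 /\ 0 <= s <= 1 /\ (r = 0 \/ r = 1 \/ s = 0 \/ s = 1).

Definition is_metric (X : Type) (d : X -> X -> R) : Prop :=
  (forall x y, 0 <= d x y) /\
  (forall x y, d x y = 0 <-> x = y) /\
  (forall x y, d x y = d y x) /\
  (forall x y z, d x z <= d x y + d y z).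

Definition is_squams (X : SqStr) : Prop :=
  is_metric (@dist X) /\
  (forall x y : X, dist x y <= 2) /\
  (forall r s t u, inM0 r s -> inM0 t u -> sqm X r s = sqm X t u -> r = t /\ s = u) /\
  (forall i r s, (i = 0 \/ i = 1) -> 0 <= r <= 1 -> 0 <= s <= 1 ->
      dist (sqm X i r) (sqm X i s) = Rabs (s - r) /\
      dist (sqm X r i) (sqm X s i) = Rabs (s - r)) /\
  (forall r s t u, inM0 r s -> inM0 t u ->
      dist (sqm X r s) (sqm X t u) >= Rabs (r - t) + Rabs (s - u)).

Definition is_morph (X Y : SqStr) (f : X -> Y) : Prop :=
  (forall x y : X, dist (f x) (f y) <= dist x y) /\
  (forall r s, inM0 r s -> f (sqm X r s) = sqm Y r s).
Arguments is_morph {X Y} f.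

Definition quot (T : Type) (Rl : T -> T -> Prop) : Type :=
  { P : T -> Prop | exists x, P = Rl x }.
Definition cls (T : Type) (Rl : T -> T -> Prop) (x : T) : quot Rl :=
  exist _ (Rl x) (ex_intro _ x eq_refl).
Definition rep (T : Type) (Rl : T -> T -> Prop) (q : quot Rl) : T :=
  proj1_sig (constructive_indefinite_description _ (proj2_sig q)).

Inductive Mi : Type := M00 | M01 | M02 | M10 | M12 | M20 | M21 | M22.
Definition Mi_eq_dec (a b : Mi) : {a = b} + {a <> b}.
Proof. decide equality. Defined.
Definition mx (m : Mi) : nat :=
  match m with M00 | M01 | M02 => 0 | M10 | M12 => 1 | M20 | M21 | M22 => 2 end%nat.
Definition my (m : Mi) : nat :=
  match m with M00 | M10 | M20 => 0 | M01 | M21 => 1 | M02 | M12 | M22 => 2 end%nat.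

Definition adjacent (m n : Mi) : Prop :=
  (mx m = mx n /\ (my m = S (my n) \/ my n = S (my m))) \/
  (my m = my n /\ (mx m = S (mx n) \/ mx n = S (mx m))).

Section Tensor.
Variable X : SqStr.

Definition tbasic (a b : Mi * X) : Prop :=
  exists p1 p2 q1 q2, inM0 p1 p2 /\ inM0 q1 q2 /\ adjacent (fst a) (fst b) /\
    snd a = sqm X p1 p2 /\ snd b = sqm X q1 q2 /\
    (INR (mx (fst a)) + p1) / 3 = (INR (mx (fst b)) + q1) / 3 /\
    (INR (my (fst a)) + p2) / 3 = (INR (my (fst b)) + q2) / 3.

Definition trel : Mi * X -> Mi * X -> Prop := clos_refl_sym_trans _ tbasic.

Definition tcar : Type := quot trel.

Definition dMX (a b : Mi * X) : R :=
  if Mi_eq_dec (fst a) (fst b) then dist (snd a) (snd b) / 3 else 2.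

Inductive chain_cost : Mi * X -> Mi * X -> R -> Prop :=
| cc_nil a : chain_cost a a 0
| cc_rel a b c r : trel a b -> chain_cost b c r -> chain_cost a c r
| cc_step a b c r : chain_cost b c r -> chain_cost a c (dMX a b + r).

Definition tdist (q1 q2 : tcar) : R :=
  real (Glb_Rbar (fun r => exists a b, proj1_sig q1 a /\ proj1_sig q2 b /\
                                       chain_cost a b r)).

Definition cidx (r : R) : nat :=
  if Rlt_dec r (1/3) then 0%nat else if Rlt_dec r (2/3) then 1%nat else 2%nat.
Definition mkM (i j : nat) : Mi :=
  match i, j with
  | 0, 0 => M00 | 0, 1 => M01 | 0, _ => M02
  | 1, 0 => M10 | 1, _ => M12
  | _, 0 => M20 | _, 1 => M21 | _, _ => M22 end%nat.
(** a cell m with p in (m + [0,1]^2)/3 (for p in M_0 this is never (1,1)) *)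
Definition cellM (r s : R) : Mi := mkM (cidx r) (cidx s).

Definition tS (r s : R) : tcar :=
  let m := cellM r s in
  cls trel (m, sqm X (3 * r - INR (mx m)) (3 * s - INR (my m))).

Definition MT : SqStr := {| car := tcar; dist := tdist; sqm := tS |}.
End Tensor.

Definition Mmap (X Y : SqStr) (f : X -> Y) (q : MT X) : MT Y :=
  let a := rep q in cls (trel Y) (fst a, f (snd a)).
Arguments Mmap {X Y} f q.

Section Completion.
Variable X : SqStr.
Variable HX : is_squams X.

Definition cauchy (x : nat -> X) : Prop :=
  forall eps, 0 < eps -> exists N, forall n m, (N <= n)%nat -> (N <= m)%nat ->
    dist (x n) (x m) < eps.

Definition CS : Type := { x : nat -> X | cauchy x }.
Definition ceq (x y : CS) : Prop :=
  is_lim_seq (fun n => dist (proj1_sig x n) (proj1_sig y n)) 0.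
Definition ccar : Type := quot ceq.
Definition cdist (q1 q2 : ccar) : R :=
  real (Lim_seq (fun n => dist (proj1_sig (rep q1) n) (proj1_sig (rep q2) n))).

Lemma cauchy_const (x : X) : cauchy (fun _ => x).
Proof.
  destruct HX as [[_ [Hd _]] _].
  intros eps He; exists 0%nat; intros n m _ _.
  rewrite (proj2 (Hd x x) eq_refl); exact He.
Qed.

Definition cS (r s : R) : ccar :=
  cls ceq (exist _ (fun _ => sqm X r s) (cauchy_const (sqm X r s))).

Definition Ccomp : SqStr := {| car := ccar; dist := cdist; sqm := cS |}.
End Completion.

Definition is_initial_alg (G : SqStr) (eta : MT G -> G) : Prop :=
  is_squams G /\ is_morph eta /\
  forall (B : SqStr), is_squams B -> forall b : MT B -> B, is_morph b ->
    exists h : G -> B, is_morph h /\ (forall u, h (eta u) = b (Mmap h u)) /\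
      forall h' : G -> B, is_morph h' -> (forall u, h' (eta u) = b (Mmap h' u)) ->
        forall x, h' x = h x.

Definition is_final_coalg (Q : SqStr) (gamma : Q -> MT Q) : Prop :=
  is_squams Q /\ is_morph gamma /\
  forall (B : SqStr), is_squams B -> forall b : B -> MT B, is_morph b ->
    exists h : B -> Q, is_morph h /\ (forall x, gamma (h x) = Mmap h (b x)) /\
      forall h' : B -> Q, is_morph h' -> (forall x, gamma (h' x) = Mmap h' (b x)) ->
        forall x, h' x = h x.

(** gamma = (C(M (x) G) ~= M (x) C(G)) o C(eta^-1), unfolded: the class of a
    Cauchy sequence (g_k) goes to m (x) [(x_j)] whenever
    eta^-1 (g_(phi j)) = m (x) x_j along a subsequence phi. *)
Definition gamma_spec (G : SqStr) (HG : is_squams G) (eta : MT G -> G)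
  (gamma : Ccomp HG -> MT (Ccomp HG)) : Prop :=
  forall (g : CS G) (m : Mi) (phi : nat -> nat) (x : CS G),
    (forall j, (phi j < phi (S j))%nat) ->
    (forall j, proj1_sig g (phi j) = eta (cls (trel G) (m, proj1_sig x j))) ->
    gamma (cls (@ceq G) g) = cls (trel (Ccomp HG)) (m, cls (@ceq G) x).

(* Main.v *)
(** Boundary points determine everything: a chain in [M (x) X] that leaves its first cell does so
    through boundary points, so distances in [M (x) X] only involve the boundary distances
    [D p q = d (S p) (S q)] and the distances of the two end points to the boundary.

    Two boundary points on one side or on adjacent sides are at l1-distance.  For opposite sides,
    a coalgebra [X -> M (x) X] forces [D (0, r) (1, s) >= 1 + |r - t| + |t - s|] with [t] in every
    finite stage of the Cantor set (a crossing must avoid the holes), and an algebra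
    [M (x) X -> X] makes this bound optimal.  Hence boundary distances in [G] are at most those in
    any coalgebra [B].

    Given a coalgebra [b : B -> M (x) B], start with any map [f_0 : B -> G] fixing the boundary and
    iterate [f_(n+1) = eta o (M (x) f_n) o b].  The sequence is uniformly Cauchy with ratio [1/3].
    If [f_n] increases distances by at most [d] then [f_(n+1)] increases them by at most [2 d / 3],
    since errors occur only in the first and the last cell of a chain; so [x |-> [(f_n x)_n]] is
    a short map [B -> C(G)], and it is a coalgebra morphism by the description of [gamma].
    It is unique because [gamma] is an isometry and [M (x) -] contracts by [1/3]. *)

From Stdlib Require Import Reals Lra Lia ClassicalEpsilon Relations.Relation_Operators.
From Stdlib Require Import FunctionalExtensionality PropExtensionality ProofIrrelevance.
From Coquelicot Require Import Coquelicot.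
Require Import Defs.
Open Scope R_scope.

Lemma Rabs_cases (x : R) : (0 <= x /\ Rabs x = x) \/ (x <= 0 /\ Rabs x = - x).
Proof. unfold Rabs; destruct (Rcase_abs x); [right | left]; lra. Qed.

Lemma Rabs_bounds (x : R) : 0 <= Rabs x /\ x <= Rabs x /\ - x <= Rabs x.
Proof. destruct (Rabs_cases x); lra. Qed.

(* Absolute values in the goal are split by sign; those in hypotheses are only
   replaced by the bounds [x <= |x|] and [- x <= |x|]. *)
Ltac absr :=
  repeat match goal with
  | |- context [Rabs ?x] =>
      let y := fresh "y" in
      destruct (Rabs_cases x) as [[? ?] | [? ?]]; set (y := Rabs x) in *; clearbody y
  end;
  repeat match goal with
  | H : context [Rabs ?x] |- _ =>
      let y := fresh "y" in
      pose proof (Rabs_bounds x); set (y := Rabs x) in *; clearbody y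
  end; lra.

(** * Chains of boundary points *)

Notation pt := (R * R)%type.
Definition inP (p : pt) : Prop := inM0 (fst p) (snd p).
Definition l1 (p q : pt) : R := Rabs (fst p - fst q) + Rabs (snd p - snd q).
Definition cpos (m : Mi) (p : pt) : pt :=
  ((INR (mx m) + fst p) / 3, (INR (my m) + snd p) / 3).

(** What the metric of a square metric space satisfies on boundary points. It is detached from any
    space so that it can be transported along symmetries of the square. *)
Record bmetric (D : pt -> pt -> R) : Prop := {
  bm_sym : forall p q, inP p -> inP q -> D p q = D q p;
  bm_tri : forall p q r, inP p -> inP q -> inP r -> D p r <= D p q + D q r;
  bm_le2 : forall p q, inP p -> inP q -> D p q <= 2;
  bm_ge : forall p q, inP p -> inP q -> l1 p q <= D p q;
  bm_v : forall i r s, i = 0 \/ i = 1 -> 0 <= r <= 1 -> 0 <= s <= 1 ->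
    D (i, r) (i, s) = Rabs (s - r);
  bm_h : forall i r s, i = 0 \/ i = 1 -> 0 <= r <= 1 -> 0 <= s <= 1 ->
    D (r, i) (s, i) = Rabs (s - r) }.

Arguments bm_sym [D]. Arguments bm_tri [D]. Arguments bm_le2 [D].
Arguments bm_ge [D]. Arguments bm_v [D]. Arguments bm_h [D].

(** Chains as in [chain_cost], but through boundary points in local coordinates. There is no step
    between different cells: its cost 2 is treated apart. The end of the chain is a parameter, so
    inductions extend chains at their start. *)
Inductive bchain (D : pt -> pt -> R) (n : Mi) (e : pt) : Mi -> pt -> R -> Prop :=
| bc_nil : bchain D n e n e 0
| bc_adj m p m' q c : adjacent m m' -> inP p -> inP q -> cpos m p = cpos m' q ->
    bchain D n e m' q c -> bchain D n e m p c
| bc_step m p q c : inP p -> inP q -> bchain D n e m q c ->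
    bchain D n e m p (D p q / 3 + c).

Lemma INR_2 : INR 2 = 2.
Proof. simpl; lra. Qed.

Ltac cells := simpl mx in *; simpl my in *;
  rewrite ?INR_2, ?INR_1, ?INR_0 in *.

Lemma cpos_eq m p n q : cpos m p = cpos n q <->
  INR (mx m) + fst p = INR (mx n) + fst q /\ INR (my m) + snd p = INR (my n) + snd q.
Proof.
  unfold cpos; split.
  - intros H; injection H; lra.
  - intros [H1 H2]; rewrite H1, H2; reflexivity.
Qed.

Lemma inP_bounds p : inP p -> 0 <= fst p <= 1 /\ 0 <= snd p <= 1.
Proof. unfold inP, inM0; tauto. Qed.

Lemma cpos_bounds m p : inP p ->
  0 <= fst (cpos m p) <= 1 /\ 0 <= snd (cpos m p) <= 1.
Proof.
  intros H; apply inP_bounds in H; unfold cpos; simpl fst; simpl snd.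
  destruct m; cells; lra.
Qed.

Section BoundaryMetric.
Variables (D : pt -> pt -> R) (HD : bmetric D).

Lemma bm_nonneg p q : inP p -> inP q -> 0 <= D p q.
Proof.
  intros Hp Hq; pose proof (bm_ge HD p q Hp Hq); unfold l1 in *.
  absr.
Qed.

Lemma bm_side p q : inP p -> inP q ->
  (fst p = fst q /\ (fst p = 0 \/ fst p = 1)) \/
  (snd p = snd q /\ (snd p = 0 \/ snd p = 1)) -> D p q = l1 p q.
Proof.
  destruct p as [p1 p2], q as [q1 q2]; intros Hp Hq H.
  apply inP_bounds in Hp; apply inP_bounds in Hq; unfold l1; simpl in *.
  destruct H as [[<- Hi] | [<- Hi]].
  - rewrite (bm_v HD) by tauto. rewrite (Rabs_minus_sym q2 p2).
    replace (p1 - p1) with 0 by lra; rewrite Rabs_R0; lra.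
  - rewrite (bm_h HD) by tauto. rewrite (Rabs_minus_sym q1 p1).
    replace (p2 - p2) with 0 by lra; rewrite Rabs_R0; lra.
Qed.

(** The corner [(fst p, snd q)] shares a side with [p] and a side with [q], and the path through it
    has length [l1 p q]. *)
Lemma bm_corner p q : inP p -> inP q ->
  (fst p = 0 \/ fst p = 1) -> (snd q = 0 \/ snd q = 1) -> D p q <= l1 p q.
Proof.
  intros Hp Hq Hi Hj.
  pose proof (inP_bounds _ Hp) as Bp; pose proof (inP_bounds _ Hq) as Bq.
  assert (Hc : inP (fst p, snd q)) by (unfold inP, inM0; simpl; tauto).
  pose proof (bm_tri HD p (fst p, snd q) q Hp Hc Hq) as T.
  rewrite (bm_side p (fst p, snd q)) in T by (simpl; tauto).
  rewrite (bm_side (fst p, snd q) q) in T by (simpl; tauto).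
  unfold l1 in *; simpl in T.
  replace (fst p - fst p) with 0 in T by lra.
  replace (snd q - snd q) with 0 in T by lra.
  rewrite Rabs_R0 in T; lra.
Qed.

Lemma bm_refl p : inP p -> D p p = 0.
Proof.
  intros H; rewrite bm_side by (auto; destruct H as [_ [_ H]]; tauto).
  unfold l1; rewrite !Rminus_diag, Rabs_R0; lra.
Qed.

Lemma l1_sym p q : l1 p q = l1 q p.
Proof. unfold l1; rewrite (Rabs_minus_sym (fst p)), (Rabs_minus_sym (snd p)); lra. Qed.

Lemma bchain_nonneg n e m p c : bchain D n e m p c -> 0 <= c.
Proof.
  induction 1; try lra.
  pose proof (bm_nonneg p q H H0); lra.
Qed.

Lemma l1_cpos m p q : l1 (cpos m p) (cpos m q) = l1 p q / 3.
Proof.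
  unfold l1, cpos; simpl.
  replace ((INR (mx m) + fst p) / 3 - (INR (mx m) + fst q) / 3)
    with ((fst p - fst q) * / 3) by lra.
  replace ((INR (my m) + snd p) / 3 - (INR (my m) + snd q) / 3)
    with ((snd p - snd q) * / 3) by lra.
  rewrite !Rabs_mult, (Rabs_pos_eq (/ 3)) by lra; lra.
Qed.

Lemma l1_tri p q r : l1 p r <= l1 p q + l1 q r.
Proof. unfold l1; absr. Qed.

Lemma l1_refl p : l1 p p = 0.
Proof. unfold l1; rewrite !Rminus_diag, Rabs_R0; lra. Qed.

(** Passing to an adjacent cell keeps the position in the plane, and by (sq2) every other step costs
    at least the planar [l1] displacement. *)
Lemma bchain_ge_l1 n e m p c : bchain D n e m p c -> l1 (cpos m p) (cpos n e) <= c.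
Proof.
  induction 1 as [| m p m' q c A Hp Hq E _ IH | m p q c Hp Hq _ IH].
  - rewrite l1_refl; lra.
  - now rewrite E.
  - pose proof (l1_tri (cpos m p) (cpos m q) (cpos n e)).
    rewrite l1_cpos in H. pose proof (bm_ge HD p q Hp Hq). lra.
Qed.

(* Outside a corner cell, the cost to come back dominates the distance to some
   point of the two sides it shares with other cells; on these two sides [D] is [l1]. *)
Lemma cell_return_M00 e p c : inP e -> bchain D M00 e M00 p c -> D p e / 3 <= c.
Proof.
  intros He H.
  (* Outside [M00], the invariant records the point [e'] at which the rest of the chain first enters
     [M00] again. *)
  enough (K : forall n p c, bchain D M00 e n p c ->
    ((n = M00 /\ D p e / 3 <= c) \/
     (n <> M00 /\ exists e', inP e' /\ (fst e' = 1 \/ snd e' = 1) /\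
       l1 (cpos n p) (cpos M00 e') + D e' e / 3 <= c))).
  { destruct (K _ _ _ H) as [[_ ?] | [[] _]]; auto. }
  clear p c H; induction 1 as [| m p m' q c A Hp Hq E _ IH | m p q c Hp Hq _ IH].
  - left; split; auto. rewrite bm_refl by auto; lra.
  - destruct IH as [[-> IH] | [N [e' [He' [Se IH]]]]].
    + right; split; [intros ->; unfold adjacent in A; simpl in A; lia |].
      exists q; split; [auto | split; [| rewrite E, l1_refl; lra]].
      apply cpos_eq in E; apply inP_bounds in Hp; apply inP_bounds in Hq.
      unfold adjacent in A; destruct m; simpl in A; try (exfalso; lia); cells; lra.
    + destruct (Mi_eq_dec m M00) as [-> | Nm].
      * left; split; auto.
        pose proof (bm_tri HD p e' e Hp He' He).
        rewrite <- E, l1_cpos in IH.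
        enough (D p e' <= l1 p e') by lra.
        assert (S : fst p = 1 \/ snd p = 1).
        { apply cpos_eq in E; apply inP_bounds in Hp; apply inP_bounds in Hq.
          unfold adjacent in A; destruct m'; simpl in A; try (exfalso; lia); cells; lra. }
        destruct S as [S | S], Se as [T | T].
        -- apply Req_le, bm_side; auto; left; lra.
        -- apply bm_corner; auto.
        -- rewrite (bm_sym HD) by auto; rewrite l1_sym; apply bm_corner; auto.
        -- apply Req_le, bm_side; auto; right; lra.
      * right; split; auto; exists e'; rewrite E; auto.
  - destruct IH as [[-> IH] | [N [e' [He' [Se IH]]]]].
    + left; split; auto. pose proof (bm_tri HD p q e Hp Hq He); lra.
    + right; split; auto; exists e'; split; auto; split; auto.
      pose proof (l1_tri (cpos m p) (cpos m q) (cpos M00 e')).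
      rewrite l1_cpos in H. pose proof (bm_ge HD p q Hp Hq). lra.
Qed.

(* An excursion from one of the opposite shared sides to the other one has to
   go around the hole, hence costs at least [2 / 3]. *)
Lemma cell_return_M01 e p c : inP e -> bchain D M01 e M01 p c -> D p e / 3 <= c.
Proof.
  intros He H.
  (* The alternatives are: inside [M01]; in the bottom row or in the top row next to it, with [e']
     the next entry point on that side; beyond the line [x = 2/3], from which the rest of the chain
     still costs [1/3]; or cost at least [2/3] already, which suffices since [D] is at most 2. *)
  enough (K : forall n p c, bchain D M01 e n p c ->
    ((n = M01 /\ D p e / 3 <= c) \/
     ((n = M00 \/ n = M10) /\ exists e', inP e' /\ snd e' = 0 /\
       l1 (cpos n p) (cpos M01 e') + D e' e / 3 <= c) \/
     ((n = M02 \/ n = M12) /\ exists e', inP e' /\ snd e' = 1 /\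
       l1 (cpos n p) (cpos M01 e') + D e' e / 3 <= c) \/
     (n <> M01 /\ 1 / 3 + Rabs (2 / 3 - fst (cpos n p)) <= c) \/
     2 / 3 <= c)).
  { destruct (K _ _ _ H) as [[_ ?] | [[[Z|Z] _] | [[[Z|Z] _] | [[[] _] |]]]];
      auto; try discriminate.
    assert (Hp : inP p) by (inversion H; subst; auto).
    pose proof (bm_le2 HD p e Hp He); lra. }
  clear p c H; induction 1 as [| m p m' q c A Hp Hq E _ IH | m p q c Hp Hq _ IH].
  - left; split; auto. rewrite bm_refl by auto; lra.
  - destruct IH as [[-> IH] | [[N [e' [He' [Se IH]]]] | [[N [e' [He' [Se IH]]]] | [[N IH] | IH]]]];
      [| | | | tauto].
    + assert (Q : (m = M00 /\ snd q = 0) \/ (m = M02 /\ snd q = 1)).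
      { apply cpos_eq in E; apply inP_bounds in Hp; apply inP_bounds in Hq.
        unfold adjacent in A; destruct m; simpl in A; try (exfalso; lia); cells;
          [left | right]; split; auto; lra. }
      destruct Q as [[-> Q] | [-> Q]]; [right; left | right; right; left];
        (split; [auto |]); exists q; rewrite E, l1_refl; (split; [auto | split; [auto | lra]]).
    + assert (Q : (m = M00 \/ m = M10) \/ (m = M01 /\ snd p = 0) \/
        (m = M20 /\ fst (cpos m p) = 2 / 3)).
      { apply cpos_eq in E; apply inP_bounds in Hp; apply inP_bounds in Hq.
        destruct N as [-> | ->]; unfold adjacent in A; unfold cpos;
          destruct m; simpl in A; try (exfalso; lia); cells; auto; right;
          [left | right]; split; auto; simpl; lra. }
      destruct Q as [Q | [[-> Q] | [-> Q]]].
      * right; left; split; auto. exists e'; rewrite E; auto.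
      * left; split; auto. rewrite <- E, l1_cpos in IH.
        rewrite <- bm_side in IH; auto; [| right; split; lra].
        pose proof (bm_tri HD p e' e Hp He' He); lra.
      * do 3 right; left; split; [discriminate |]. rewrite <- E in IH.
        pose proof (bm_nonneg e' e He' He). unfold l1 in IH.
        replace (fst (cpos M01 e')) with (fst e' / 3) in IH by (unfold cpos; cells; simpl; lra).
        apply inP_bounds in He'. rewrite Q in *. absr.
    + assert (Q : (m = M02 \/ m = M12) \/ (m = M01 /\ snd p = 1) \/
        (m = M22 /\ fst (cpos m p) = 2 / 3)).
      { apply cpos_eq in E; apply inP_bounds in Hp; apply inP_bounds in Hq.
        destruct N as [-> | ->]; unfold adjacent in A; unfold cpos;
          destruct m; simpl in A; try (exfalso; lia); cells; auto; right;
          [left | right]; split; auto; simpl; lra. }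
      destruct Q as [Q | [[-> Q] | [-> Q]]].
      * right; right; left; split; auto. exists e'; rewrite E; auto.
      * left; split; auto. rewrite <- E, l1_cpos in IH.
        rewrite <- bm_side in IH; auto; [| right; split; lra].
        pose proof (bm_tri HD p e' e Hp He' He); lra.
      * do 3 right; left; split; [discriminate |]. rewrite <- E in IH.
        pose proof (bm_nonneg e' e He' He). unfold l1 in IH.
        replace (fst (cpos M01 e')) with (fst e' / 3) in IH by (unfold cpos; cells; simpl; lra).
        apply inP_bounds in He'. rewrite Q in *. absr.
    + rewrite <- E in IH. destruct (Mi_eq_dec m M01) as [-> | Nm]; [| tauto].
      do 4 right.
      replace (fst (cpos M01 p)) with (fst p / 3) in IH by (unfold cpos; cells; simpl; lra).
      apply inP_bounds in Hp. absr.
  - pose proof (bm_ge HD p q Hp Hq) as G. pose proof (bm_nonneg p q Hp Hq).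
    destruct IH as [[-> IH] | [[N [e' [He' [Se IH]]]] | [[N [e' [He' [Se IH]]]] | [[N IH] | IH]]]].
    + left; split; auto. pose proof (bm_tri HD p q e Hp Hq He); lra.
    + right; left; split; auto; exists e'; split; auto; split; auto.
      pose proof (l1_tri (cpos m p) (cpos m q) (cpos M01 e')) as T.
      rewrite l1_cpos in T. lra.
    + right; right; left; split; auto; exists e'; split; auto; split; auto.
      pose proof (l1_tri (cpos m p) (cpos m q) (cpos M01 e')) as T.
      rewrite l1_cpos in T. lra.
    + do 3 right; left; split; auto. unfold l1, cpos in *. simpl in *. absr.
    + do 4 right; lra.
Qed.

End BoundaryMetric.

(** * Symmetries of the square *)

(** Transposition [tp] and left-right reflection [rp], with their actions [tM] and [rM] on cells,
    generate all symmetries of the square. The eight cells form two orbits, those of [M00] and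
    [M01]. *)
Definition tp (p : pt) : pt := (snd p, fst p).
Definition tM (m : Mi) : Mi :=
  match m with M00 => M00 | M01 => M10 | M02 => M20 | M10 => M01 | M12 => M21
  | M20 => M02 | M21 => M12 | M22 => M22 end.
Definition rp (p : pt) : pt := (1 - fst p, snd p).
Definition rM (m : Mi) : Mi :=
  match m with M00 => M20 | M01 => M21 | M02 => M22 | M10 => M10 | M12 => M12
  | M20 => M00 | M21 => M01 | M22 => M02 end.

Lemma tp_tp p : tp (tp p) = p.
Proof. now destruct p. Qed.
Lemma rp_rp p : rp (rp p) = p.
Proof. destruct p; unfold rp; simpl; f_equal; lra. Qed.
Lemma inP_tp p : inP p -> inP (tp p).
Proof. unfold inP, inM0; simpl; tauto. Qed.
Lemma inP_rp p : inP p -> inP (rp p).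
Proof. unfold inP, inM0; simpl; lra. Qed.
Lemma cpos_tp m p : cpos (tM m) (tp p) = tp (cpos m p).
Proof. now destruct m. Qed.
Lemma cpos_rp m p : cpos (rM m) (rp p) = rp (cpos m p).
Proof. unfold cpos, rp; destruct m; cells; simpl; f_equal; lra. Qed.
Lemma adjacent_tM m n : adjacent m n -> adjacent (tM m) (tM n).
Proof. unfold adjacent; destruct m, n; simpl; lia. Qed.
Lemma adjacent_rM m n : adjacent m n -> adjacent (rM m) (rM n).
Proof. unfold adjacent; destruct m, n; simpl; lia. Qed.

Lemma bmetric_tp D : bmetric D -> bmetric (fun p q => D (tp p) (tp q)).
Proof.
  intros H; split; intros.
  - apply (bm_sym H); now apply inP_tp.
  - apply (bm_tri H); now apply inP_tp.
  - apply (bm_le2 H); now apply inP_tp.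
  - pose proof (bm_ge H _ _ (inP_tp _ H0) (inP_tp _ H1)) as G.
    unfold l1 in *; simpl in *; lra.
  - now apply (bm_h H).
  - now apply (bm_v H).
Qed.

Lemma bmetric_rp D : bmetric D -> bmetric (fun p q => D (rp p) (rp q)).
Proof.
  intros H; split; intros.
  - apply (bm_sym H); now apply inP_rp.
  - apply (bm_tri H); now apply inP_rp.
  - apply (bm_le2 H); now apply inP_rp.
  - pose proof (bm_ge H _ _ (inP_rp _ H0) (inP_rp _ H1)) as G.
    unfold l1 in *; simpl in *.
    rewrite (Rabs_minus_sym (fst p)).
    replace (fst q - fst p) with (1 - fst p - (1 - fst q)) by lra; lra.
  - apply (bm_v H); simpl; lra.
  - unfold rp; simpl; rewrite (bm_h H) by lra.
    rewrite Rabs_minus_sym; f_equal; lra.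
Qed.

Lemma bchain_tp D n e m p c : bchain D n e m p c ->
  bchain (fun p q => D (tp p) (tp q)) (tM n) (tp e) (tM m) (tp p) c.
Proof.
  induction 1.
  - apply bc_nil.
  - apply bc_adj with (tM m') (tp q); auto using inP_tp, adjacent_tM. rewrite !cpos_tp; congruence.
  - rewrite <- (tp_tp p) at 2; rewrite <- (tp_tp q) at 1.
    apply (bc_step (fun p q => D (tp p) (tp q))); auto using inP_tp.
Qed.

Lemma bchain_rp D n e m p c : bchain D n e m p c ->
  bchain (fun p q => D (rp p) (rp q)) (rM n) (rp e) (rM m) (rp p) c.
Proof.
  induction 1.
  - apply bc_nil.
  - apply bc_adj with (rM m') (rp q); auto using inP_rp, adjacent_rM. rewrite !cpos_rp; congruence.
  - rewrite <- (rp_rp p) at 2; rewrite <- (rp_rp q) at 1.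
    apply (bc_step (fun p q => D (rp p) (rp q))); auto using inP_rp.
Qed.

Lemma cell_return D (HD : bmetric D) m e p c :
  inP e -> bchain D m e m p c -> D p e / 3 <= c.
Proof.
  (* The metric is quantified inside [Q] because a symmetry moves the cell and the metric
     together. *)
  set (Q := fun m => forall D, bmetric D -> forall e p c,
    inP e -> bchain D m e m p c -> D p e / 3 <= c).
  assert (T : forall m, Q (tM m) -> Q m).
  { intros m' H D' HD' e' p' c' He' H'.
    pose proof (H _ (bmetric_tp _ HD') _ _ _ (inP_tp _ He') (bchain_tp _ _ _ _ _ _ H')).
    simpl in H0; now rewrite !tp_tp in H0. }
  assert (F : forall m, Q (rM m) -> Q m).
  { intros m' H D' HD' e' p' c' He' H'.
    pose proof (H _ (bmetric_rp _ HD') _ _ _ (inP_rp _ He') (bchain_rp _ _ _ _ _ _ H')).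
    simpl in H0; now rewrite !rp_rp in H0. }
  assert (Q0 : Q M00) by exact cell_return_M00.
  assert (Q1 : Q M01) by exact cell_return_M01.
  revert e p c; enough (Q m) by auto.
  destruct m; auto; solve [apply F; auto | apply T; auto | apply F, T; auto
    | apply T, F; auto | apply F, T, F; auto].
Qed.

(** * Crossing the square *)

Fixpoint cantor (n : nat) (t : R) : Prop :=
  match n with
  | O => 0 <= t <= 1
  | S n => exists t', cantor n t' /\ (t = t' / 3 \/ t = (2 + t') / 3)
  end.

Lemma cantor_0 n : cantor n 0.
Proof. induction n; simpl; [lra | exists 0; split; auto; lra]. Qed.

Lemma cantor_1 n : cantor n 1.
Proof. induction n; simpl; [lra | exists 1; split; auto; lra]. Qed.

(* [sub_tensor D] is what a coalgebra [X -> M (x) X] gives for the boundary metric of [X],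
   [super_tensor D] what an algebra [M (x) X -> X] gives. *)
Definition sub_tensor (D : pt -> pt -> R) : Prop :=
  forall p q, inP p -> inP q -> forall eps, 0 < eps -> 2 <= D p q + eps \/
    exists m p' n q' c, inP p' /\ inP q' /\ cpos m p' = p /\ cpos n q' = q /\
      bchain D n q' m p' c /\ c <= D p q + eps.

Definition super_tensor (D : pt -> pt -> R) : Prop :=
  forall m p n q c, inP p -> inP q -> inP (cpos m p) -> inP (cpos n q) ->
    bchain D n q m p c -> D (cpos m p) (cpos n q) <= c.

(** The bound is the length of a path that runs vertically from height [r] to [t], straight across,
    and vertically to [s]. The slack [eps] comes from the infimum behind [sub_tensor], and [t] may
    depend on it. *)
Definition crossing_ge (n : nat) (D : pt -> pt -> R) : Prop :=
  forall r s, 0 <= r <= 1 -> 0 <= s <= 1 -> forall eps, 0 < eps ->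
    exists t, cantor n t /\ 1 + Rabs (r - t) + Rabs (t - s) - eps <= D (0, r) (1, s).

Lemma inP_left r : 0 <= r <= 1 -> inP (0, r).
Proof. unfold inP, inM0; simpl; lra. Qed.

Lemma inP_right r : 0 <= r <= 1 -> inP (1, r).
Proof. unfold inP, inM0; simpl; lra. Qed.

Lemma mx_01 m : mx m = 1%nat -> my m = 0%nat \/ my m = 2%nat.
Proof. destruct m; simpl; lia. Qed.

Lemma mx_cases m : mx m = 0%nat \/ mx m = 1%nat \/ mx m = 2%nat.
Proof. destruct m; simpl; lia. Qed.

(* A chain from left to right crosses one of the two cells of the middle column,
   at heights given by the next stage of the Cantor set. *)
Lemma crossing_bchain D n m p e s eps c : bmetric D -> crossing_ge n D -> 0 < eps ->
  inP e -> forall n0, cpos n0 e = (1, s) -> bchain D n0 e m p c ->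
  (mx m = 2%nat /\ (1 - fst (cpos m p)) + Rabs (snd (cpos m p) - s) <= c) \/
  (mx m = 1%nat /\ exists u, 0 <= u <= 1 /\
     D p (1, u) / 3 + 1 / 3 + Rabs ((INR (my m) + u) / 3 - s) <= c) \/
  (exists t, cantor (S n) t /\
     (1 - fst (cpos m p)) + Rabs (snd (cpos m p) - t) + Rabs (t - s) - eps <= c).
Proof.
  intros HD HC Heps He n0 Hpos.
  (* Read from its end, the chain is in the right column, or in a middle cell that it will leave at
     height [u] of the right side, or it still has to cross a middle cell at a Cantor height [t]. *)
  induction 1 as [| m p m' q c A Hp Hq E _ IH | m p q c Hp Hq _ IH].
  - left. rewrite Hpos; simpl.
    assert (fst (cpos n0 e) = 1) by (now rewrite Hpos).
    apply inP_bounds in He. split.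
    + unfold cpos in H; simpl fst in H. destruct n0; auto; cells; lra.
    + replace (s - s) with 0 by lra; rewrite Rabs_R0; lra.
  - pose proof (inP_bounds _ Hp) as Bp; pose proof (inP_bounds _ Hq) as Bq.
    destruct IH as [[M IH] | [[M [u [Hu IH]]] | [t [Ht IH]]]].
    + rewrite <- E in IH. pose proof (proj1 (cpos_eq _ _ _ _) E) as [E1 E2].
      rewrite M in E1.
      destruct (mx_cases m) as [Z | [Z | Z]]; [exfalso | right; left | left; auto].
      * rewrite Z in E1; cells; lra.
      * split; auto; exists (snd p); split; [tauto |].
        rewrite Z in E1. rewrite INR_1, INR_2 in E1.
        assert (P1 : fst p = 1) by lra.
        rewrite <- P1 at 1. rewrite <- surjective_pairing, (bm_refl _ HD) by auto.
        unfold cpos in IH; simpl fst in IH; simpl snd in IH.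
        rewrite Z, INR_1 in IH. lra.
    + pose proof (proj1 (cpos_eq _ _ _ _) E) as [E1 E2]. rewrite M in E1.
      destruct (mx_cases m) as [Z | [Z | Z]]; rewrite Z in E1; cells.
      * right; right.
        assert (Q : q = (0, snd q)) by (rewrite (surjective_pairing q) at 1; f_equal; lra).
        (* The chain enters a middle cell from the left at height [snd q] and leaves it at height
           [u], so the hypothesis on stage [n] applies inside this cell. Its row is 0 or 2, so
           rescaling [t] gives a point of the next stage. *)
        destruct (HC (snd q) u ltac:(tauto) Hu eps Heps) as [t [Ht B]].
        rewrite <- Q in B.
        exists ((INR (my m') + t) / 3); split.
        -- exists t; split; auto. destruct (mx_01 _ M) as [V | V]; rewrite V; cells; lra.
        -- rewrite E; unfold cpos; simpl fst; simpl snd.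
           rewrite M, INR_1. absr.
      * exfalso. destruct (mx_01 _ M), (mx_01 _ Z); unfold adjacent in A; lia.
      * left; split; auto.
        assert (Q : q = (1, snd q)) by (rewrite (surjective_pairing q) at 1; f_equal; lra).
        rewrite E; unfold cpos; simpl fst; simpl snd.
        rewrite Q, (bm_v HD) in IH by tauto. rewrite M, INR_1. absr.
    + right; right; exists t; rewrite E; auto.
  - pose proof (bm_ge HD p q Hp Hq) as G. unfold l1 in G.
    destruct IH as [[M IH] | [[M [u [Hu IH]]] | [t [Ht IH]]]].
    + left; split; auto. unfold cpos in *; simpl fst in *; simpl snd in *. absr.
    + right; left; split; auto; exists u; split; auto.
      pose proof (bm_tri HD p q (1, u) Hp Hq (inP_right _ Hu)); lra.
    + right; right; exists t; split; auto.
      unfold cpos in *; simpl fst in *; simpl snd in *. absr.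
Qed.

Lemma crossing_step D n : bmetric D -> sub_tensor D -> crossing_ge n D ->
  crossing_ge (S n) D.
Proof.
  intros HD HS HC r s Hr Hs eps Heps.
  destruct (HS (0, r) (1, s) (inP_left _ Hr) (inP_right _ Hs) (eps / 2) ltac:(lra))
    as [H | [m [p [n0 [q [c [Hp [Hq [P1 [P2 [H L]]]]]]]]]]].
  (* Here the distance is 2 up to [eps / 2]. A detour along the bottom has length [1 + r + s], one
     along the top [3 - r - s], and the shorter one is at most 2. *)
  - destruct (Rle_dec (r + s) 1).
    + exists 0; split; [apply cantor_0 | absr].
    + exists 1; split; [apply cantor_1 | absr].
  - destruct (crossing_bchain D n m p q s (eps / 2) c HD HC ltac:(lra) Hq n0 P2 H)
      as [[M K] | [[M [u [Hu K]]] | [t [Ht K]]]].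
    (* The chain starts at abscissa 0, hence in the left column. *)
    1,2: exfalso; apply (f_equal fst) in P1; unfold cpos in P1; simpl in P1;
      rewrite M in P1; apply inP_bounds in Hp; cells; lra.
    exists t; split; auto. rewrite P1 in K. simpl in K. lra.
Qed.

Lemma crossing_lower D n : bmetric D -> sub_tensor D -> crossing_ge n D.
Proof.
  intros HD HS; induction n; [| now apply crossing_step].
  (* Stage 0 is the whole interval, and with [t = r] the bound follows from (sq2). *)
  intros r s Hr Hs eps Heps; exists r; split; [exact Hr |].
  pose proof (bm_ge HD _ _ (inP_left _ Hr) (inP_right _ Hs)) as G.
  unfold l1 in G; simpl in G. absr.
Qed.

(** At stage 0 the bottom side is a straight crossing of length 1. Three copies of a crossing, side
    by side in the bottom or the top row and scaled by [1/3], form a crossing again, and the error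
    in height shrinks by [1/3]. *)
Lemma straight_crossing D n t : bmetric D -> super_tensor D -> cantor n t ->
  exists t', 0 <= t' <= 1 /\ Rabs (t - t') <= (1 / 3) ^ n /\ D (0, t') (1, t') <= 1.
Proof.
  intros HD HS; revert t; induction n as [| n IH]; simpl; intros t Ht.
  - exists 0; split; [lra |]; split; [absr |].
    rewrite (bm_h HD) by lra. absr.
  - destruct Ht as [t0 [Ht0 Ht]]. destruct (IH _ Ht0) as [t' [B [L K]]].
    assert (HL := inP_left _ B); assert (HR := inP_right _ B).
    destruct Ht as [-> | ->].
    + exists (t' / 3); split; [lra |]; split; [absr |].
      assert (E1 : cpos M00 (0, t') = (0, t' / 3)) by (unfold cpos; cells; simpl; f_equal; lra).
      assert (E2 : cpos M20 (1, t') = (1, t' / 3)) by (unfold cpos; cells; simpl; f_equal; lra).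
      rewrite <- E1, <- E2.
      apply Rle_trans with (D (0, t') (1, t') / 3 + (D (0, t') (1, t') / 3 +
        (D (0, t') (1, t') / 3 + 0))); [| lra].
      apply HS; auto; [rewrite E1; apply inP_left; lra | rewrite E2; apply inP_right; lra |].
      apply bc_step; auto.
      apply bc_adj with M10 (0, t'); auto;
        [unfold adjacent; simpl; lia | apply cpos_eq; cells; simpl; lra |].
      apply bc_step; auto.
      apply bc_adj with M20 (0, t'); auto;
        [unfold adjacent; simpl; lia | apply cpos_eq; cells; simpl; lra |].
      apply bc_step; auto. apply bc_nil.
    + exists ((2 + t') / 3); split; [lra |]; split; [absr |].
      assert (E1 : cpos M02 (0, t') = (0, (2 + t') / 3)) by (unfold cpos; cells; simpl; f_equal; lra).
      assert (E2 : cpos M22 (1, t') = (1, (2 + t') / 3)) by (unfold cpos; cells; simpl; f_equal; lra).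
      rewrite <- E1, <- E2.
      apply Rle_trans with (D (0, t') (1, t') / 3 + (D (0, t') (1, t') / 3 +
        (D (0, t') (1, t') / 3 + 0))); [| lra].
      apply HS; auto; [rewrite E1; apply inP_left; lra | rewrite E2; apply inP_right; lra |].
      apply bc_step; auto.
      apply bc_adj with M12 (0, t'); auto;
        [unfold adjacent; simpl; lia | apply cpos_eq; cells; simpl; lra |].
      apply bc_step; auto.
      apply bc_adj with M22 (0, t'); auto;
        [unfold adjacent; simpl; lia | apply cpos_eq; cells; simpl; lra |].
      apply bc_step; auto. apply bc_nil.
Qed.

Lemma pow_lt_eps x eps : 0 <= x < 1 -> 0 < eps -> exists n, x ^ n < eps.
Proof.
  intros Hx He.
  destruct (pow_lt_1_zero x ltac:(rewrite Rabs_pos_eq; lra) eps He) as [n H].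
  exists n; specialize (H n (le_n n)).
  rewrite Rabs_pos_eq in H; auto. apply pow_le; lra.
Qed.

(** The lower bound for [E] has a Cantor height [t]. For [D], go along the left side to a nearby
    straight crossing at [t'], across, and along the right side. Replacing [t] by [t'] costs at most
    twice [eps / 4], and the lower bound loses [eps / 2]. *)
Lemma crossing_compare D E r s : bmetric D -> super_tensor D ->
  bmetric E -> sub_tensor E -> 0 <= r <= 1 -> 0 <= s <= 1 ->
  D (0, r) (1, s) <= E (0, r) (1, s).
Proof.
  intros HD SD HE SE Hr Hs; apply le_epsilon; intros eps Heps.
  destruct (pow_lt_eps (1 / 3) (eps / 4) ltac:(lra) ltac:(lra)) as [n Hn].
  destruct (crossing_lower E n HE SE r s Hr Hs (eps / 2) ltac:(lra)) as [t [Ht L]].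
  destruct (straight_crossing D n t HD SD Ht) as [t' [B [K U]]].
  assert (HL := inP_left _ B); assert (HR := inP_right _ B).
  assert (Hl := inP_left _ Hr); assert (Hr' := inP_right _ Hs).
  pose proof (bm_tri HD _ _ _ Hl HL Hr') as T1.
  pose proof (bm_tri HD _ _ _ HL HR Hr') as T2.
  rewrite (bm_v HD 0 r t') in T1 by auto. rewrite (bm_v HD 1 t' s) in T2 by auto.
  assert (Rabs (t' - r) <= Rabs (r - t) + Rabs (t - t')) by absr.
  assert (Rabs (s - t') <= Rabs (t - s) + Rabs (t - t')) by absr.
  lra.
Qed.

Lemma sub_tensor_tp D : sub_tensor D -> sub_tensor (fun p q => D (tp p) (tp q)).
Proof.
  intros H p q Hp Hq eps He.
  destruct (H _ _ (inP_tp _ Hp) (inP_tp _ Hq) eps He) as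
    [L | [m [p' [n [q' [c [Hp' [Hq' [P1 [P2 [C L]]]]]]]]]]]; [now left | right].
  exists (tM m), (tp p'), (tM n), (tp q'), c.
  rewrite !cpos_tp, P1, P2, !tp_tp.
  split; [now apply inP_tp |]; split; [now apply inP_tp |].
  split; [auto |]; split; [auto |]; split; [now apply bchain_tp | exact L].
Qed.

Lemma super_tensor_tp D : super_tensor D -> super_tensor (fun p q => D (tp p) (tp q)).
Proof.
  intros H m p n q c Hp Hq Ip Iq C. simpl. rewrite <- !cpos_tp.
  apply H; try now apply inP_tp.
  1,2: rewrite cpos_tp; now apply inP_tp.
  apply bchain_tp in C.
  enough (K : D = (fun p q => D (tp (tp p)) (tp (tp q)))) by (now rewrite K).
  apply functional_extensionality; intros a; apply functional_extensionality; intros b.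
  now rewrite !tp_tp.
Qed.

(** On a common side or on adjacent sides [D] is at most [l1], hence at most [E]. Left against right
    is [crossing_compare]; bottom against top is the same for the transposed metrics, which is why
    [cross] is stated for arbitrary ones. *)
Theorem boundary_compare D E p q : bmetric D -> super_tensor D ->
  bmetric E -> sub_tensor E -> inP p -> inP q -> D p q <= E p q.
Proof.
  intros HD SD HE SE Hp Hq.
  assert (easy : D p q <= l1 p q -> D p q <= E p q).
  { intros H; pose proof (bm_ge HE p q Hp Hq); lra. }
  assert (cross : forall D E, bmetric D -> super_tensor D -> bmetric E -> sub_tensor E ->
    forall p q, inP p -> inP q -> fst p = 0 -> fst q = 1 ->
    D p q <= E p q /\ D q p <= E q p).
  { clear; intros D E HD SD HE SE [p1 p2] [q1 q2] Hp Hq; simpl; intros -> ->.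
    rewrite (bm_sym HD (1, q2)), (bm_sym HE (1, q2)) by auto.
    apply inP_bounds in Hp; apply inP_bounds in Hq; simpl in *.
    split; apply crossing_compare; tauto. }
  pose proof (cross D E HD SD HE SE) as cx.
  pose proof (cross _ _ (bmetric_tp _ HD) (super_tensor_tp _ SD)
    (bmetric_tp _ HE) (sub_tensor_tp _ SE) (tp p) (tp q) (inP_tp _ Hp) (inP_tp _ Hq)) as cy1.
  pose proof (cross _ _ (bmetric_tp _ HD) (super_tensor_tp _ SD)
    (bmetric_tp _ HE) (sub_tensor_tp _ SE) (tp q) (tp p) (inP_tp _ Hq) (inP_tp _ Hp)) as cy2.
  simpl in cy1, cy2; rewrite !tp_tp in cy1, cy2.
  pose proof Hp as [_ [_ Zp]]; pose proof Hq as [_ [_ Zq]].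
  destruct Zp as [Zp | [Zp | [Zp | Zp]]], Zq as [Zq | [Zq | [Zq | Zq]]];
    try solve [apply (cx p q); auto | apply (cx q p); auto | apply cy1; auto | apply cy2; auto
      | apply easy, bm_corner; auto
      | apply easy; rewrite (bm_sym HD), l1_sym by auto; apply bm_corner; auto
      | apply easy, Req_le, bm_side; auto; solve [left; lra | right; lra]].
Qed.

(** * The tensor [M (x) X] *)

Section Quotient.
Variables (T : Type) (Rl : T -> T -> Prop).
Hypotheses (Hrefl : forall x, Rl x x) (Hsym : forall x y, Rl x y -> Rl y x)
  (Htrans : forall x y z, Rl x y -> Rl y z -> Rl x z).

Lemma cls_eq x y : Rl x y -> cls Rl x = cls Rl y.
Proof.
  intros H; unfold cls; apply subset_eq_compat.
  apply functional_extensionality; intros z; apply propositional_extensionality.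
  split; eauto.
Qed.

Lemma cls_inv x y : cls Rl x = cls Rl y -> Rl x y.
Proof.
  intros H; apply (f_equal (@proj1_sig _ _)) in H; simpl in H; rewrite H; auto.
Qed.

Lemma cls_rep (q : quot Rl) : cls Rl (rep q) = q.
Proof.
  unfold rep; destruct (constructive_indefinite_description _ (proj2_sig q)) as [x Hx]; simpl.
  destruct q as [P HP]; simpl in *; unfold cls; apply subset_eq_compat; auto.
Qed.

Lemma rep_cls x : Rl x (rep (cls Rl x)).
Proof. apply cls_inv; now rewrite cls_rep. Qed.
End Quotient.

Arguments cls_eq [T Rl].
Arguments cls_inv [T Rl].
Arguments cls_rep [T Rl].
Arguments rep_cls [T Rl].

(** [real] sends infinite values to 0, so a lower bound and a member are required to make the
    infimum finite. *)
Lemma Glb_real_le (E : R -> Prop) k r : (forall x, E x -> k <= x) -> E r ->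
  real (Glb_Rbar E) <= r.
Proof.
  intros Hk Hr; destruct (Glb_Rbar_correct E) as [H1 H2].
  specialize (H1 r Hr); assert (Hk' : Rbar_le k (Glb_Rbar E)).
  { apply H2; intros x Hx; apply (Hk x Hx). }
  destruct (Glb_Rbar E); simpl in *; tauto.
Qed.

Lemma Glb_real_ge (E : R -> Prop) k r : (forall x, E x -> k <= x) -> E r ->
  k <= real (Glb_Rbar E).
Proof.
  intros Hk Hr; destruct (Glb_Rbar_correct E) as [H1 H2].
  specialize (H1 r Hr); assert (Hk' : Rbar_le k (Glb_Rbar E)).
  { apply H2; intros x Hx; apply (Hk x Hx). }
  destruct (Glb_Rbar E); simpl in *; tauto.
Qed.

Lemma trel_refl X a : trel X a a.
Proof. apply rst_refl. Qed.
Lemma trel_sym X a b : trel X a b -> trel X b a.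
Proof. apply rst_sym. Qed.
Lemma trel_trans X a b c : trel X a b -> trel X b c -> trel X a c.
Proof. apply rst_trans. Qed.
Local Hint Resolve trel_refl trel_sym : core.

Definition tcls (X : SqStr) (m : Mi) (x : X) : MT X := cls (trel X) (m, x).
Arguments tcls {X}.

Lemma tcls_eq (X : SqStr) (m n : Mi) (x y : X) : trel X (m, x) (n, y) -> tcls m x = tcls n y.
Proof. apply cls_eq; eauto using trel_trans. Qed.

Lemma tcls_surj (X : SqStr) (u : MT X) : exists m x, u = tcls m x.
Proof.
  exists (fst (rep u)), (snd (rep u)); unfold tcls.
  now rewrite <- surjective_pairing, cls_rep.
Qed.

Definition bnd (X : SqStr) (p : pt) : X := sqm X (fst p) (snd p).
Definition bD (X : SqStr) (p q : pt) : R := dist (bnd X p) (bnd X q).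

Section Squams.
Variables (X : SqStr) (HX : is_squams X).

Lemma dist_nonneg (x y : X) : 0 <= dist x y.
Proof. apply HX. Qed.
Lemma dist_refl (x : X) : dist x x = 0.
Proof. now apply HX. Qed.
Lemma dist_eq (x y : X) : dist x y = 0 -> x = y.
Proof. apply HX. Qed.
Lemma dist_sym (x y : X) : dist x y = dist y x.
Proof. apply HX. Qed.
Lemma dist_tri (y x z : X) : dist x z <= dist x y + dist y z.
Proof. apply HX. Qed.
Lemma dist_le2 (x y : X) : dist x y <= 2.
Proof. apply HX. Qed.

Lemma bnd_inj p q : inP p -> inP q -> bnd X p = bnd X q -> p = q.
Proof.
  destruct HX as [_ [_ [H _]]]; intros Hp Hq E; apply H in E; auto.
  destruct p, q; simpl in E; f_equal; tauto.
Qed.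

Lemma bmetric_bD : bmetric (bD X).
Proof.
  split; intros; unfold bD.
  - apply dist_sym.
  - apply dist_tri.
  - apply dist_le2.
  - destruct HX as [_ [_ [_ [_ K]]]]; unfold l1; now apply Rge_le, K.
  - destruct HX as [_ [_ [_ [K _]]]]; now apply K.
  - destruct HX as [_ [_ [_ [K _]]]]; now apply K.
Qed.

(** * Chains and the quotient pseudometric *)

Lemma dMX_nonneg a b : 0 <= dMX X a b.
Proof.
  unfold dMX; destruct Mi_eq_dec; [| lra].
  pose proof (dist_nonneg (snd a) (snd b)); lra.
Qed.

Lemma dMX_sym a b : dMX X a b = dMX X b a.
Proof.
  unfold dMX; destruct Mi_eq_dec as [e | e], Mi_eq_dec as [e' | e']; auto;
    try congruence. now rewrite dist_sym.
Qed.

Lemma chain_nonneg a b r : chain_cost X a b r -> 0 <= r.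
Proof. induction 1; auto; try lra. pose proof (dMX_nonneg a b); lra. Qed.

Lemma chain_app a b c r s : chain_cost X a b r -> chain_cost X b c s ->
  chain_cost X a c (r + s).
Proof.
  induction 1; intros K.
  - now rewrite Rplus_0_l.
  - apply cc_rel with b; auto.
  - rewrite Rplus_assoc; apply cc_step; auto.
Qed.

Lemma chain_one_step a b : chain_cost X a b (dMX X a b).
Proof. rewrite <- Rplus_0_r; apply cc_step, cc_nil. Qed.

Lemma chain_one_rel a b : trel X a b -> chain_cost X a b 0.
Proof. intros H; apply cc_rel with b; auto using cc_nil. Qed.

Lemma chain_sym a b r : chain_cost X a b r -> chain_cost X b a r.
Proof.
  induction 1.
  - apply cc_nil.
  - rewrite <- Rplus_0_r; apply chain_app with b; auto using chain_one_rel.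
  - rewrite Rplus_comm, dMX_sym; apply chain_app with b; auto using chain_one_step.
Qed.

Lemma tdist_le m x n y r : chain_cost X (m, x) (n, y) r ->
  dist (tcls m x) (tcls n y) <= r.
Proof.
  intros H; apply Glb_real_le with 0.
  - intros s [a [b [_ [_ K]]]]; now apply chain_nonneg in K.
  - exists (m, x), (n, y); simpl; auto.
Qed.

Lemma tdist_ge m x n y k : (forall r, chain_cost X (m, x) (n, y) r -> k <= r) ->
  k <= dist (tcls m x) (tcls n y).
Proof.
  (* The direct jump is a chain, so the set of costs is inhabited. *)
  intros H; apply Glb_real_ge with (dMX X (m, x) (n, y)).
  - intros s [a [b [Ha [Hb K]]]]; simpl in Ha, Hb.
    apply H; apply cc_rel with a; auto.
    rewrite <- Rplus_0_r; apply chain_app with b; auto using chain_one_rel.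
  - exists (m, x), (n, y); simpl; auto using chain_one_step.
Qed.

Lemma tdist_approx m x n y eps : 0 < eps -> exists r,
  chain_cost X (m, x) (n, y) r /\ r <= dist (tcls m x) (tcls n y) + eps.
Proof.
  intros He; destruct (classic (exists r,
    chain_cost X (m, x) (n, y) r /\ r <= dist (tcls m x) (tcls n y) + eps)) as [H | H]; auto.
  exfalso; assert (K : dist (tcls m x) (tcls n y) + eps <= dist (tcls m x) (tcls n y)).
  { apply tdist_ge; intros r Hr; destruct (Rle_dec r (dist (tcls m x) (tcls n y) + eps)).
    - exfalso; eauto.
    - lra. }
  lra.
Qed.

Lemma tdist_cell m (x y : X) : dist (tcls m x) (tcls m y) <= dist x y / 3.
Proof.
  apply tdist_le. replace (dist x y / 3) with (dMX X (m, x) (m, y)).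
  - apply chain_one_step.
  - unfold dMX; simpl; destruct Mi_eq_dec; congruence.
Qed.

Lemma tdist_le2 (u v : MT X) : dist u v <= 2.
Proof.
  destruct (tcls_surj X u) as [m [x ->]], (tcls_surj X v) as [n [y ->]].
  apply Rle_trans with (dMX X (m, x) (n, y)); [apply tdist_le, chain_one_step |].
  unfold dMX; destruct Mi_eq_dec; [simpl | lra].
  pose proof (dist_le2 x y); lra.
Qed.

Lemma tdist_nonneg (u v : MT X) : 0 <= dist u v.
Proof.
  destruct (tcls_surj X u) as [m [x ->]], (tcls_surj X v) as [n [y ->]].
  apply tdist_ge; intros r; apply chain_nonneg.
Qed.

Lemma tdist_refl (u : MT X) : dist u u = 0.
Proof.
  apply Rle_antisym; [| apply tdist_nonneg].
  destruct (tcls_surj X u) as [m [x ->]]; apply tdist_le, cc_nil.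
Qed.

Lemma tdist_sym (u v : MT X) : dist u v = dist v u.
Proof.
  destruct (tcls_surj X u) as [m [x ->]], (tcls_surj X v) as [n [y ->]].
  apply Rle_antisym; apply tdist_ge; intros r Hr; apply tdist_le, chain_sym, Hr.
Qed.

Lemma tdist_tri (v u w : MT X) : dist u w <= dist u v + dist v w.
Proof.
  destruct (tcls_surj X u) as [m [x ->]], (tcls_surj X v) as [n [y ->]],
    (tcls_surj X w) as [l [z ->]].
  apply le_epsilon; intros eps He.
  destruct (tdist_approx m x n y (eps / 2) ltac:(lra)) as [r [Hr Lr]].
  destruct (tdist_approx n y l z (eps / 2) ltac:(lra)) as [s [Hs Ls]].
  pose proof (tdist_le _ _ _ _ _ (chain_app _ _ _ _ _ Hr Hs)); lra.
Qed.

(** Only boundary points undergo a nontrivial identification. Having the same boundary chains to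
    every end is a form of this that passes through composition. *)
Lemma trel_bnd a b : trel X a b -> a = b \/ exists p q, inP p /\ inP q /\
  snd a = bnd X p /\ snd b = bnd X q /\
  forall n e c, bchain (bD X) n e (fst a) p c <-> bchain (bD X) n e (fst b) q c.
Proof.
  induction 1 as [a b H | a | a b _ IH | a b c _ IH1 _ IH2].
  - destruct H as [p1 [p2 [q1 [q2 [Hp [Hq [A [Ea [Eb [E1 E2]]]]]]]]]].
    right; exists (p1, p2), (q1, q2); do 4 (split; [assumption |]).
    intros n e c; split; intros K.
    + apply bc_adj with (fst a) (p1, p2); auto.
      * unfold adjacent in *; lia.
      * apply cpos_eq; simpl; lra.
    + apply bc_adj with (fst b) (q1, q2); auto.
      apply cpos_eq; simpl; lra.
  - now left.
  - destruct IH as [-> | [p [q [Hp [Hq [Ea [Eb K]]]]]]]; [now left | right].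
    exists q, p; do 4 (split; [assumption |]). intros; now rewrite K.
  - destruct IH1 as [-> | [p [q [Hp [Hq [Ea [Eb K]]]]]]]; [assumption |].
    destruct IH2 as [<- | [p' [q' [Hp' [Hq' [Ea' [Eb' K']]]]]]].
    + right; exists p, q; do 4 (split; [assumption |]); auto.
    + right; exists p, q'; do 4 (split; [assumption |]).
      (* Injectivity of [S]: the middle point of two composed identifications has a single boundary
         coordinate. *)
      assert (q = p') as <- by (apply bnd_inj; congruence).
      intros; now rewrite K.
Qed.

(* A chain leaving its initial cell does so through the boundary, and comes into its final
   cell through the boundary. *)
Lemma chain_normal_form a c r : chain_cost X a c r ->
  2 <= r \/ (fst a = fst c /\ dist (snd a) (snd c) / 3 <= r) \/
  exists p q r', inP p /\ inP q /\ bchain (bD X) (fst c) q (fst a) p r' /\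
    dist (snd a) (bnd X p) / 3 + r' + dist (bnd X q) (snd c) / 3 <= r.
Proof.
  induction 1 as [a | a b c r Hab Hbc IH | a b c r Hbc IH].
  - right; left; split; auto. rewrite dist_refl; lra.
  - destruct (trel_bnd a b Hab) as [-> | [p [q [Hp [Hq [Ea [Eb K]]]]]]]; [assumption |].
    destruct IH as [IH | [[F IH] | [p' [q' [r' [Hp' [Hq' [C IH]]]]]]]]; [now left | right; right..].
    + exists p, q, 0; do 2 (split; [assumption |]); split.
      * apply K; rewrite F; apply bc_nil.
      * rewrite Ea, <- Eb, dist_refl; lra.
    + exists p, q', (bD X q p' / 3 + r'); do 2 (split; [assumption |]); split.
      * apply K, bc_step; auto.
      * unfold bD; rewrite Ea, <- Eb, dist_refl; lra.
  - pose proof (dMX_nonneg a b) as N; pose proof (chain_nonneg _ _ _ Hbc) as N'.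
    unfold dMX in *; destruct Mi_eq_dec as [e | e]; [| left; lra].
    destruct IH as [IH | [[F IH] | [p' [q' [r' [Hp' [Hq' [C IH]]]]]]]];
      [left; lra | right; left | right; right].
    + split; [congruence |]. pose proof (dist_tri (snd b) (snd a) (snd c)); lra.
    + exists p', q', r'; rewrite e; do 3 (split; [assumption |]).
      pose proof (dist_tri (snd b) (snd a) (bnd X p')); lra.
Qed.

Ltac via_corner via l v := apply (via l v);
  [unfold inP, inM0; simpl; lra | apply cpos_eq; cells; simpl; lra
  | unfold adjacent; simpl; lia | unfold adjacent; simpl; lia].

(** This makes the choice of a cell in [tS] immaterial. *)
Lemma same_position_trel m p n q : inP p -> inP q -> cpos m p = cpos n q ->
  trel X (m, bnd X p) (n, bnd X q).
Proof.
  assert (adj : forall m p n q, inP p -> inP q -> cpos m p = cpos n q -> adjacent m n ->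
    trel X (m, bnd X p) (n, bnd X q)).
  { clear; intros m p n q Hp Hq E A; apply rst_step.
    exists (fst p), (snd p), (fst q), (snd q); do 2 (split; [assumption |]); simpl.
    injection E; auto. }
  intros Hp Hq E.
  destruct (classic (adjacent m n)) as [A | A]; [now apply adj |].
  pose proof (proj1 (cpos_eq _ _ _ _) E) as [E1 E2].
  pose proof (inP_bounds _ Hp); pose proof (inP_bounds _ Hq).
  destruct (Mi_eq_dec m n) as [-> | N].
  { assert (p = q) as -> by (destruct p, q; simpl in *; f_equal; lra). apply trel_refl. }
  (* two diagonal neighbours are both adjacent to a corner cell *)
  assert (via : forall l (v : pt), inP v -> cpos m p = cpos l v -> adjacent m l -> adjacent l n ->
    trel X (m, bnd X p) (n, bnd X q)).
  { intros l v Hv Ev A1 A2; apply trel_trans with (l, bnd X v); apply adj; auto; congruence. }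
  clear adj E.
  destruct m, n; cells; try (exfalso; lra);
    try (exfalso; apply N; reflexivity); try (exfalso; apply A; unfold adjacent; simpl; lia).
  all: solve [via_corner via M00 (1, 1) | via_corner via M20 (0, 1)
    | via_corner via M02 (1, 0) | via_corner via M22 (0, 0)].
Qed.

Lemma bchain_chain n e m p c : bchain (bD X) n e m p c ->
  chain_cost X (m, bnd X p) (n, bnd X e) c.
Proof.
  induction 1 as [| m p m' q c A Hp Hq E _ IH | m p q c Hp Hq _ IH].
  - apply cc_nil.
  - apply cc_rel with (m', bnd X q); auto. now apply same_position_trel.
  - replace (bD X p q / 3) with (dMX X (m, bnd X p) (m, bnd X q)).
    + now apply cc_step.
    + unfold dMX; simpl; destruct Mi_eq_dec; [reflexivity | congruence].
Qed.

(** This is the source of (sq2) for the tensor. Chains of cost 2 are harmless because the [l1]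
    diameter of the unit square is 2. *)
Lemma tdist_ge_l1 m p n q : inP p -> inP q ->
  l1 (cpos m p) (cpos n q) <= dist (tcls m (bnd X p)) (tcls n (bnd X q)).
Proof.
  intros Hp Hq; apply tdist_ge; intros r Hr.
  pose proof bmetric_bD as HB.
  destruct (chain_normal_form _ _ _ Hr) as
    [L | [[F L] | [p' [q' [r' [Hp' [Hq' [C L]]]]]]]]; simpl in *.
  - pose proof (cpos_bounds m p Hp); pose proof (cpos_bounds n q Hq).
    unfold l1; absr.
  - subst n; rewrite l1_cpos. pose proof (bm_ge HB p q Hp Hq); unfold bD in *; lra.
  - apply bchain_ge_l1 in C; auto.
    pose proof (bm_ge HB p p' Hp Hp') as G1; pose proof (bm_ge HB q' q Hq' Hq) as G2.
    unfold bD in G1, G2.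
    pose proof (l1_tri (cpos m p) (cpos m p') (cpos n q)) as T1.
    pose proof (l1_tri (cpos m p') (cpos n q') (cpos n q)) as T2.
    rewrite l1_cpos in T1, T2; lra.
Qed.

(** By [cell_return], leaving the cell and coming back is never a shortcut. *)
Lemma tdist_same_cell m (x y : X) : dist (tcls m x) (tcls m y) = dist x y / 3.
Proof.
  apply Rle_antisym; [apply tdist_cell |]. apply tdist_ge; intros r Hr.
  destruct (chain_normal_form _ _ _ Hr) as
    [L | [[F L] | [p' [q' [r' [Hp' [Hq' [C L]]]]]]]]; simpl in *.
  - pose proof (dist_le2 x y); lra.
  - exact L.
  - apply cell_return in C; auto using bmetric_bD. unfold bD in C.
    pose proof (dist_tri (bnd X p') x y); pose proof (dist_tri (bnd X q') (bnd X p') y); lra.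
Qed.

(** * The boundary is closed, and the pseudometric is a metric *)

Lemma side_closed (g : R -> X) x :
  (forall r s, 0 <= r <= 1 -> 0 <= s <= 1 -> dist (g r) (g s) = Rabs (s - r)) ->
  exists r, 0 <= r <= 1 /\ forall s, 0 <= s <= 1 -> dist x (g r) <= dist x (g s).
Proof.
  (* Clamping to the unit interval extends the side to a continuous function on all reals, whose
     minimum on the compact interval is attained. *)
  intros Hg; set (cl := fun r => Rmax 0 (Rmin 1 r)).
  assert (Hcl : forall r, 0 <= cl r <= 1).
  { intros r; unfold cl, Rmax, Rmin; repeat destruct Rle_dec; lra. }
  assert (Hid : forall r, 0 <= r <= 1 -> cl r = r).
  { intros r Hr; unfold cl, Rmax, Rmin; repeat destruct Rle_dec; lra. }
  assert (Hlip : forall r s, Rabs (cl s - cl r) <= Rabs (s - r)).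
  { intros r s; unfold cl, Rmax, Rmin; repeat destruct Rle_dec; absr. }
  destruct (continuity_ab_min (fun r => dist x (g (cl r))) 0 1) as [r [Hr B]]; [lra | |].
  - intros c _ eps He; exists eps; split; auto; intros s [_ Hs].
    simpl in *; unfold Rdist in *.
    apply Rle_lt_trans with (Rabs (s - c)); auto.
    pose proof (dist_tri (g (cl s)) x (g (cl c))).
    pose proof (dist_tri (g (cl c)) x (g (cl s))).
    rewrite (Hg (cl s) (cl c)) in H by auto. rewrite (Hg (cl c) (cl s)) in H0 by auto.
    rewrite (Rabs_minus_sym (cl c)) in H. specialize (Hlip c s).
    apply Rabs_le; lra.
  - exists r; split; auto; intros s Hs. specialize (Hr s Hs).
    now rewrite !Hid in Hr.
Qed.

(** If [x] lies on none of the four sides, it has a positive distance from each of them, and the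
    least of the four contradicts the hypothesis. *)
Lemma bnd_closed x : (forall eps, 0 < eps -> exists p, inP p /\ dist x (bnd X p) < eps) ->
  exists p, inP p /\ x = bnd X p.
Proof.
  intros H. pose proof bmetric_bD as HB.
  assert (side : forall g : R -> pt, (forall r, 0 <= r <= 1 -> inP (g r)) ->
    (forall r s, 0 <= r <= 1 -> 0 <= s <= 1 -> bD X (g r) (g s) = Rabs (s - r)) ->
    (exists p, inP p /\ x = bnd X p) \/
    exists eps, 0 < eps /\ forall r, 0 <= r <= 1 -> eps <= dist x (bnd X (g r))).
  { intros g Ig Hg; destruct (side_closed (fun r => bnd X (g r)) x Hg) as [r [Br Hr]].
    destruct (Rle_lt_or_eq_dec 0 (dist x (bnd X (g r)))) as [L | L].
    - apply dist_nonneg.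
    - right; eauto.
    - left; exists (g r); split; auto; apply dist_eq; auto. }
  destruct (side (fun r => (0, r))) as [? | [e1 [P1 L1]]]; auto.
  { intros; unfold inP, inM0; simpl; lra. } { intros; apply (bm_v HB); auto. }
  destruct (side (fun r => (1, r))) as [? | [e2 [P2 L2]]]; auto.
  { intros; unfold inP, inM0; simpl; lra. } { intros; apply (bm_v HB); auto. }
  destruct (side (fun r => (r, 0))) as [? | [e3 [P3 L3]]]; auto.
  { intros; unfold inP, inM0; simpl; lra. } { intros; apply (bm_h HB); auto. }
  destruct (side (fun r => (r, 1))) as [? | [e4 [P4 L4]]]; auto.
  { intros; unfold inP, inM0; simpl; lra. } { intros; apply (bm_h HB); auto. }
  exfalso. destruct (H (Rmin (Rmin e1 e2) (Rmin e3 e4))) as [[p1 p2] [[B1 [B2 S]] L]].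
  { repeat apply Rmin_pos; auto. }
  simpl in *.
  pose proof (Rmin_l (Rmin e1 e2) (Rmin e3 e4)); pose proof (Rmin_r (Rmin e1 e2) (Rmin e3 e4)).
  pose proof (Rmin_l e1 e2); pose proof (Rmin_r e1 e2).
  pose proof (Rmin_l e3 e4); pose proof (Rmin_r e3 e4).
  specialize (L1 p2 B2); specialize (L2 p2 B2); specialize (L3 p1 B1); specialize (L4 p1 B1).
  destruct S as [-> | [-> | [-> | ->]]]; lra.
Qed.

(** For different cells, cheap chains pass through boundary points near [x] and near [y], so both
    are boundary points by closedness. The [l1] bound then gives them the same position. *)
Lemma tdist_eq (u v : MT X) : dist u v = 0 -> u = v.
Proof.
  destruct (tcls_surj X u) as [m [x ->]], (tcls_surj X v) as [n [y ->]]; intros H.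
  destruct (Mi_eq_dec m n) as [<- | N].
  { rewrite tdist_same_cell in H. rewrite (dist_eq x y); [auto | lra]. }
  assert (K : forall eps, 0 < eps -> exists p q, inP p /\ inP q /\
    dist x (bnd X p) < eps /\ dist y (bnd X q) < eps).
  { intros eps He; destruct (tdist_approx m x n y (Rmin 1 (eps / 4))) as [r [Hr Lr]].
    { apply Rmin_pos; lra. }
    pose proof (Rmin_l 1 (eps / 4)); pose proof (Rmin_r 1 (eps / 4)).
    destruct (chain_normal_form _ _ _ Hr) as
      [L | [[F L] | [p [q [r' [Hp [Hq [C L]]]]]]]]; simpl in *; [lra | congruence |].
    exists p, q; do 2 (split; [assumption |]). rewrite (dist_sym y).
    apply bchain_nonneg in C; [| apply bmetric_bD].
    pose proof (dist_nonneg x (bnd X p)); pose proof (dist_nonneg (bnd X q) y); lra. }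
  destruct (bnd_closed x) as [p [Hp ->]].
  { intros eps He; destruct (K eps He) as [p [q [? [? [? ?]]]]]; eauto. }
  destruct (bnd_closed y) as [q [Hq ->]].
  { intros eps He; destruct (K eps He) as [? [q [? [? [? ?]]]]]; eauto. }
  apply tcls_eq, same_position_trel; auto.
  pose proof (tdist_ge_l1 m p n q Hp Hq) as G; rewrite H in G; unfold l1 in G.
  pose proof (Rabs_bounds (fst (cpos m p) - fst (cpos n q))).
  pose proof (Rabs_bounds (snd (cpos m p) - snd (cpos n q))).
  rewrite (surjective_pairing (cpos m p)), (surjective_pairing (cpos n q)).
  f_equal; lra.
Qed.

(** * The boundary map of the tensor *)

Lemma cell_spec z : inP z ->
  let m := cellM (fst z) (snd z) in
  let p := (3 * fst z - INR (mx m), 3 * snd z - INR (my m)) in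
  inP p /\ cpos m p = z.
Proof.
  intros [B1 [B2 H]]; simpl; split.
  - unfold inP, inM0; simpl.
    unfold cellM, cidx; repeat destruct Rlt_dec; cbn [mkM]; cells; lra.
  - destruct z as [z1 z2]; unfold cpos; cbn [fst snd]; f_equal; lra.
Qed.

Lemma tS_cell m p : inP p -> inP (cpos m p) -> bnd (MT X) (cpos m p) = tcls m (bnd X p).
Proof.
  intros Hp Hz; destruct (cell_spec _ Hz) as [Hq E].
  apply tcls_eq; apply (same_position_trel _ (_, _)); auto.
Qed.

Lemma tS_bnd z : inP z -> exists m p, inP p /\ cpos m p = z /\ bnd (MT X) z = tcls m (bnd X p).
Proof.
  intros Hz; destruct (cell_spec _ Hz) as [Hq E]; eauto.
Qed.

Lemma tdist_bnd_ge_l1 p q : inP p -> inP q -> l1 p q <= bD (MT X) p q.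
Proof.
  intros Hp Hq; unfold bD.
  destruct (tS_bnd p Hp) as [m [p' [Hp' [<- ->]]]].
  destruct (tS_bnd q Hq) as [n [q' [Hq' [<- ->]]]].
  now apply tdist_ge_l1.
Qed.

(** Shortness on consecutive intervals extends to their union by the triangle inequality at the
    break points [1/3] and [2/3]. *)
Lemma short_from_thirds (F : R -> MT X) :
  (forall k, k = 0 \/ k = 1 \/ k = 2 -> forall r s,
    k / 3 <= r <= (k + 1) / 3 -> k / 3 <= s <= (k + 1) / 3 -> dist (F r) (F s) <= Rabs (s - r)) ->
  forall r s, 0 <= r <= 1 -> 0 <= s <= 1 -> dist (F r) (F s) <= Rabs (s - r).
Proof.
  intros H.
  assert (le : forall r s, 0 <= r -> r <= s -> s <= 1 -> dist (F r) (F s) <= s - r).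
  { assert (H' : forall k, k = 0 \/ k = 1 \/ k = 2 -> forall r s,
      k / 3 <= r -> r <= s -> s <= (k + 1) / 3 -> dist (F r) (F s) <= s - r).
    { intros k Hk r s ? ? ?; pose proof (H k Hk r s ltac:(lra) ltac:(lra)).
      rewrite Rabs_pos_eq in *; lra. }
    assert (A : forall r s, 0 <= r -> r <= s -> s <= 2 / 3 -> dist (F r) (F s) <= s - r).
    { intros r s ? ? ?.
      destruct (Rle_dec s (1 / 3)); [apply (H' 0); lra |].
      destruct (Rle_dec (1 / 3) r); [apply (H' 1); lra |].
      pose proof (tdist_tri (F (1 / 3)) (F r) (F s)).
      pose proof (H' 0 ltac:(lra) r (1 / 3)); pose proof (H' 1 ltac:(lra) (1 / 3) s); lra. }
    intros r s ? ? ?.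
    destruct (Rle_dec s (2 / 3)); [apply A; lra |].
    destruct (Rle_dec (2 / 3) r); [apply (H' 2); lra |].
    pose proof (tdist_tri (F (2 / 3)) (F r) (F s)).
    pose proof (A r (2 / 3)); pose proof (H' 2 ltac:(lra) (2 / 3) s); lra. }
  intros r s Hr Hs; destruct (Rle_dec r s).
  - rewrite Rabs_pos_eq by lra; apply le; lra.
  - rewrite Rabs_minus_sym, tdist_sym, Rabs_pos_eq by lra; apply le; lra.
Qed.

Lemma side_in_cell m p q : inP p -> inP q -> inP (cpos m p) -> inP (cpos m q) ->
  bD (MT X) (cpos m p) (cpos m q) <= bD X p q / 3.
Proof.
  intros; unfold bD; rewrite !tS_cell by auto; apply tdist_cell.
Qed.

(** Each third of a side lies in one cell, where a side of [X] appears scaled by [1/3]. The converse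
    inequalities are instances of the [l1] bound. *)
Lemma tensor_sq1 i r s : i = 0 \/ i = 1 -> 0 <= r <= 1 -> 0 <= s <= 1 ->
  bD (MT X) (i, r) (i, s) <= Rabs (s - r) /\ bD (MT X) (r, i) (s, i) <= Rabs (s - r).
Proof.
  intros Hi Hr Hs; pose proof bmetric_bD as HB.
  assert (third : forall x, Rabs (3 * x) / 3 = Rabs x)
    by (intros x; rewrite Rabs_mult, Rabs_pos_eq; lra).
  split; revert Hs; revert Hr; revert r s.
  - apply (short_from_thirds (fun r => bnd (MT X) (i, r))).
    intros k Hk r s Hr Hs.
    assert (V : exists m, forall t, (i, t) = cpos m (i, 3 * t - k)).
    { destruct Hi as [-> | ->], Hk as [-> | [-> | ->]];
        [exists M00 | exists M01 | exists M02 | exists M20 | exists M21 | exists M22];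
        intros t; unfold cpos; cells; simpl; f_equal; lra. }
    destruct V as [m V]; rewrite (V r), (V s).
    eapply Rle_trans; [apply side_in_cell; rewrite <- ?V; unfold inP, inM0; simpl; lra |].
    rewrite (bm_v HB) by lra. rewrite <- (third (s - r)). apply Req_le; do 2 f_equal; lra.
  - apply (short_from_thirds (fun r => bnd (MT X) (r, i))).
    intros k Hk r s Hr Hs.
    assert (V : exists m, forall t, (t, i) = cpos m (3 * t - k, i)).
    { destruct Hi as [-> | ->], Hk as [-> | [-> | ->]];
        [exists M00 | exists M10 | exists M20 | exists M02 | exists M12 | exists M22];
        intros t; unfold cpos; cells; simpl; f_equal; lra. }
    destruct V as [m V]; rewrite (V r), (V s).
    eapply Rle_trans; [apply side_in_cell; rewrite <- ?V; unfold inP, inM0; simpl; lra |].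
    rewrite (bm_h HB) by lra. rewrite <- (third (s - r)). apply Req_le; do 2 f_equal; lra.
Qed.

Theorem squams_MT : is_squams (MT X).
Proof.
  pose proof tdist_bnd_ge_l1 as G.
  assert (G' : forall r s t u, inM0 r s -> inM0 t u ->
    Rabs (r - t) + Rabs (s - u) <= dist (sqm (MT X) r s) (sqm (MT X) t u))
    by (intros r s t u H1 H2; exact (G (r, s) (t, u) H1 H2)).
  split; [| split; [| split; [| split]]].
  - split; [exact tdist_nonneg |]; split; [| split; [exact tdist_sym |]].
    + intros u v; split; [apply tdist_eq | intros ->; apply tdist_refl].
    + intros u v w; apply tdist_tri.
  - exact tdist_le2.
  - intros r s t u H1 H2 E; specialize (G' r s t u H1 H2).
    rewrite E, tdist_refl in G'.
    pose proof (Rabs_bounds (r - t)); pose proof (Rabs_bounds (s - u)); lra.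
  - intros i r s Hi Hr Hs. destruct (tensor_sq1 i r s Hi Hr Hs) as [L1 L2].
    unfold bD, bnd in L1, L2; cbn [fst snd] in L1, L2.
    split; apply Rle_antisym; auto.
    + pose proof (G' i r i s ltac:(unfold inM0; lra) ltac:(unfold inM0; lra)).
      rewrite Rabs_minus_sym; pose proof (Rabs_pos (i - i)); lra.
    + pose proof (G' r i s i ltac:(unfold inM0; lra) ltac:(unfold inM0; lra)).
      rewrite Rabs_minus_sym; pose proof (Rabs_pos (i - i)); lra.
  - intros; apply Rle_ge; auto.
Qed.

End Squams.

(** * The functor on maps *)

(** Separated from shortness because the iterates that approximate the coalgebra morphism are short
    only up to an error. *)
Definition fixes_boundary (X Y : SqStr) (f : X -> Y) : Prop :=
  forall p, inP p -> f (bnd X p) = bnd Y p.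
Arguments fixes_boundary {X Y} f.

Lemma morph_fixes_boundary (X Y : SqStr) (f : X -> Y) : is_morph f -> fixes_boundary f.
Proof. intros H p Hp; now apply H. Qed.

Lemma Mmap_rep (X Y : SqStr) (f : X -> Y) (u : MT X) :
  Mmap f u = tcls (fst (rep u)) (f (snd (rep u))).
Proof. reflexivity. Qed.

Lemma tcls_rep (X : SqStr) (u : MT X) : tcls (fst (rep u)) (snd (rep u)) = u.
Proof. unfold tcls; now rewrite <- surjective_pairing, cls_rep. Qed.

(** [Mmap] is computed on a chosen representative; preservation of the boundary makes the result
    independent of it. *)
Lemma Mmap_tcls (X Y : SqStr) (f : X -> Y) m x : fixes_boundary f ->
  Mmap f (tcls m x) = tcls m (f x).
Proof.
  intros Hf.
  assert (K : forall a a', trel X a a' -> trel Y (fst a, f (snd a)) (fst a', f (snd a'))).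
  { induction 1 as [a a' H | a | a a' _ IH | a a' a'' _ IH1 _ IH2]; auto.
    - destruct H as [p1 [p2 [q1 [q2 [Hp [Hq [A [Ea [Eb E]]]]]]]]].
      apply rst_step; exists p1, p2, q1, q2; simpl.
      rewrite Ea, Eb; do 3 (split; [assumption |]).
      split; [apply (Hf (p1, p2) Hp) |]; split; [apply (Hf (q1, q2) Hq) | assumption].
    - eapply trel_trans; eauto. }
  symmetry; rewrite Mmap_rep; apply tcls_eq, (K (m, x) (rep (tcls m x))).
  apply (rep_cls (trel_refl X)); auto.
Qed.

Lemma Mmap_fixes_boundary (X Y : SqStr) (f : X -> Y) :
  fixes_boundary f -> fixes_boundary (Mmap f).
Proof.
  intros Hf z Hz.
  destruct (tS_bnd X z Hz) as [m [p [Hp [E ->]]]].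
  rewrite Mmap_tcls, Hf by auto; subst z; symmetry; now apply tS_cell.
Qed.

Lemma bchain_mono D E n e m p c : (forall p q, inP p -> inP q -> E p q <= D p q) ->
  bchain D n e m p c -> exists c', bchain E n e m p c' /\ c' <= c.
Proof.
  intros H; induction 1 as [| m p m' q c A Hp Hq Eq _ IH | m p q c Hp Hq _ IH].
  - exists 0; split; [apply bc_nil | lra].
  - destruct IH as [c' [K L]]; exists c'; split; auto; apply bc_adj with m' q; auto.
  - destruct IH as [c' [K L]]; exists (E p q / 3 + c'); split; [now apply bc_step |].
    specialize (H p q Hp Hq); lra.
Qed.

(* An error [d] is only made in the first and the last cell of a chain, whence the factor
   [2 / 3 < 1]. *)
Lemma tdist_compare (X Y : SqStr) (HX : is_squams X) (HY : is_squams Y) d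
  m (x : X) n (x' : X) (y y' : Y) : 0 <= d ->
  (forall p q, inP p -> inP q -> bD Y p q <= bD X p q) ->
  (forall p, inP p -> dist y (bnd Y p) <= dist x (bnd X p) + d) ->
  (forall p, inP p -> dist (bnd Y p) y' <= dist (bnd X p) x' + d) ->
  dist y y' <= dist x x' + d ->
  dist (tcls m y) (tcls n y') <= dist (tcls m x) (tcls n x') + 2 / 3 * d.
Proof.
  intros Hd HS H1 H2 H3.
  enough (dist (tcls m y) (tcls n y') - 2 / 3 * d <= dist (tcls m x) (tcls n x')) by lra.
  apply tdist_ge; auto; intros r Hr.
  destruct (chain_normal_form X HX _ _ _ Hr) as
    [L | [[F L] | [p [q [r' [Hp [Hq [C L]]]]]]]]; simpl in *.
  - pose proof (tdist_le2 Y HY (tcls m y) (tcls n y')); simpl in *; lra.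
  - subst n; pose proof (tdist_cell Y HY m y y'); simpl in *; lra.
  - destruct (bchain_mono _ _ _ _ _ _ _ HS C) as [c [C' Lc]].
    apply (bchain_chain Y) in C'.
    pose proof (tdist_le Y HY _ _ _ _ _ C') as K.
    pose proof (tdist_tri Y HY (tcls m (bnd Y p)) (tcls m y) (tcls n y')) as T1.
    pose proof (tdist_tri Y HY (tcls n (bnd Y q)) (tcls m (bnd Y p)) (tcls n y')) as T2.
    pose proof (tdist_cell Y HY m y (bnd Y p)) as C1.
    pose proof (tdist_cell Y HY n (bnd Y q) y') as C2.
    specialize (H1 p Hp); specialize (H2 q Hq). simpl in *; lra.
Qed.

Lemma Mmap_almost_short (X Y : SqStr) (HX : is_squams X) (HY : is_squams Y) (f : X -> Y) d :
  0 <= d -> fixes_boundary f ->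
  (forall p q, inP p -> inP q -> bD Y p q <= bD X p q) ->
  (forall x y, dist (f x) (f y) <= dist x y + d) ->
  forall u v, dist (Mmap f u) (Mmap f v) <= dist u v + 2 / 3 * d.
Proof.
  intros Hd Hf HS H u v.
  rewrite (Mmap_rep _ _ f u), (Mmap_rep _ _ f v).
  replace (dist u v) with (dist (tcls (fst (rep u)) (snd (rep u)))
    (tcls (fst (rep v)) (snd (rep v)))) by (now rewrite !tcls_rep).
  apply tdist_compare; auto; intros p Hp; rewrite <- Hf by auto; apply H.
Qed.

Lemma morph_bD (X Y : SqStr) (f : X -> Y) p q : is_morph f -> inP p -> inP q ->
  bD Y p q <= bD X p q.
Proof.
  intros [Hs Hf] Hp Hq; unfold bD, bnd; rewrite <- !Hf by auto; apply Hs.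
Qed.

Lemma Mmap_morph (X Y : SqStr) (HX : is_squams X) (HY : is_squams Y) (f : X -> Y) :
  is_morph f -> is_morph (Mmap f).
Proof.
  intros Hf; pose proof (morph_fixes_boundary _ _ _ Hf) as Hb; split.
  - intros u v; rewrite <- (Rplus_0_r (dist u v)), <- (Rmult_0_r (2 / 3)).
    apply Mmap_almost_short; auto; try lra.
    + intros p q; apply morph_bD with f; auto.
    + intros x y; rewrite Rplus_0_r; apply Hf.
  - intros r s H; apply (Mmap_fixes_boundary _ _ f Hb (r, s) H).
Qed.

Lemma comp_morph (X Y Z : SqStr) (f : X -> Y) (g : Y -> Z) :
  is_morph f -> is_morph g -> is_morph (fun x => g (f x)).
Proof.
  intros [Hf1 Hf2] [Hg1 Hg2]; split.
  - intros x y; eapply Rle_trans; eauto.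
  - intros r s H; rewrite Hf2, Hg2; auto.
Qed.

Lemma Mmap_comp (X Y Z : SqStr) (f : X -> Y) (g : Y -> Z) (u : MT X) :
  fixes_boundary f -> fixes_boundary g ->
  Mmap g (Mmap f u) = Mmap (fun x => g (f x)) u.
Proof. intros Hf Hg; rewrite !(Mmap_rep _ _ _ u); now apply Mmap_tcls. Qed.

Lemma Mmap_id (X : SqStr) (u : MT X) : Mmap (fun x => x) u = u.
Proof. apply tcls_rep. Qed.

(** Lambek's argument: the algebra morphism [h] from [G] to [MT G] with structure [Mmap eta] is
    inverse to [eta]. Both maps are short, so [eta] is an isometry. *)
Lemma lambek (G : SqStr) (eta : MT G -> G) : is_initial_alg eta ->
  (forall x, exists u, x = eta u) /\ (forall u v, dist (eta u) (eta v) = dist u v).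
Proof.
  intros [HG [He Hi]].
  pose proof (squams_MT G HG) as HM.
  pose proof (morph_fixes_boundary _ _ _ He) as Be.
  destruct (Hi (MT G) HM (Mmap eta) (Mmap_morph _ _ HM HG _ He)) as [h [Hh [Eh _]]].
  pose proof (morph_fixes_boundary _ _ _ Hh) as Bh.
  assert (S : forall x, eta (h x) = x).
  { destruct (Hi G HG eta He) as [i [_ [_ U]]].
    intros x; transitivity (i x); [| symmetry].
    - apply (U (fun x => eta (h x))); [now apply comp_morph |].
      intros u; rewrite Eh; f_equal; now apply Mmap_comp.
    - apply (U (fun x => x)).
      + split; intros; [lra | auto].
      + intros u; now rewrite Mmap_id. }
  assert (T : forall u, h (eta u) = u).
  { intros u; rewrite Eh, Mmap_comp by auto.
    rewrite <- (Mmap_id G u) at 2; f_equal.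
    apply functional_extensionality; auto. }
  split; [intros x; exists (h x); auto |].
  intros u v; apply Rle_antisym; [apply He |].
  rewrite <- (T u) at 1; rewrite <- (T v) at 1; apply Hh.
Qed.

(** * Boundary metrics of algebras and coalgebras *)

Lemma bchain_snoc D n q m p e c : inP q -> inP e -> bchain D n q m p c ->
  bchain D n e m p (c + D q e / 3).
Proof.
  intros Hq He; induction 1 as [| m p m' r c A Hp Hr E _ IH | m p r c Hp Hr _ IH].
  - rewrite Rplus_comm; apply bc_step; auto; apply bc_nil.
  - apply bc_adj with m' r; auto.
  - rewrite Rplus_assoc; now apply bc_step.
Qed.

(** The structure map is short and keeps boundary points, so a distance in [B] bounds one in the
    tensor. The normal form of a nearly optimal chain there has boundary end points, and two
    boundary steps complete it to a [bchain]. *)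
Lemma coalgebra_sub_tensor (B : SqStr) (HB : is_squams B) (b : B -> MT B) :
  is_morph b -> sub_tensor (bD B).
Proof.
  intros Hb p q Hp Hq eps He.
  pose proof (morph_bD _ _ b p q Hb Hp Hq) as L; unfold bD at 1 in L.
  destruct (tS_bnd B p Hp) as [m [p' [Hp' [Ep Sp]]]].
  destruct (tS_bnd B q Hq) as [n [q' [Hq' [Eq Sq]]]].
  rewrite Sp, Sq in L.
  destruct (tdist_approx B m (bnd B p') n (bnd B q') eps He) as [r [Hr Lr]].
  destruct (chain_normal_form B HB _ _ _ Hr) as
    [K | [[F K] | [p1 [q1 [c [Hp1 [Hq1 [C K]]]]]]]]; simpl in *; [left; lra | right | right].
  - subst n; exists m, p', m, q', (bD B p' q' / 3 + 0).
    do 4 (split; [assumption |]); split; [apply bc_step; auto; apply bc_nil | unfold bD in *; lra].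
  - exists m, p', n, q', (bD B p' p1 / 3 + (c + bD B q1 q' / 3)).
    do 4 (split; [assumption |]); split; [| unfold bD in *; lra].
    apply bc_step; auto; now apply bchain_snoc.
Qed.

Lemma algebra_super_tensor (G : SqStr) (HG : is_squams G) (eta : MT G -> G) :
  is_morph eta -> super_tensor (bD G).
Proof.
  intros He m p n q c Hp Hq Ip Iq C.
  eapply Rle_trans; [apply (morph_bD _ _ eta); auto |].
  unfold bD; rewrite !tS_cell by auto.
  apply tdist_le; auto; now apply bchain_chain.
Qed.

(** * Cauchy completion *)

Section Completion.
Variables (X : SqStr) (HX : is_squams X).

Lemma squeeze_0 (u v : nat -> R) : (forall n, 0 <= u n <= v n) -> is_lim_seq v 0 ->
  is_lim_seq u 0.
Proof.
  intros H Hv; apply is_lim_seq_le_le with (fun _ => 0) v; auto; apply is_lim_seq_const.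
Qed.

Lemma ceq_refl (x : CS X) : ceq x x.
Proof.
  apply is_lim_seq_ext with (fun _ => 0); [| apply is_lim_seq_const].
  intros n; symmetry; now apply dist_refl.
Qed.

Lemma ceq_sym (x y : CS X) : ceq x y -> ceq y x.
Proof. apply is_lim_seq_ext; intros n; now apply dist_sym. Qed.

Lemma ceq_trans (x y z : CS X) : ceq x y -> ceq y z -> ceq x z.
Proof.
  intros H1 H2; pose proof (is_lim_seq_plus' _ _ _ _ H1 H2) as H; rewrite Rplus_0_r in H.
  apply squeeze_0 with (2 := H); intros n; split; [now apply dist_nonneg | now apply dist_tri].
Qed.

Lemma ccls_eq (x y : CS X) : ceq x y -> cls (@ceq X) x = cls (@ceq X) y.
Proof. apply cls_eq; [exact ceq_sym | exact ceq_trans]. Qed.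

Local Notation Q := (Ccomp HX).
Definition ccls (x : CS X) : Ccomp HX := cls (@ceq X) x.

Lemma ccls_surj (u : Q) : exists x, u = ccls x.
Proof. exists (rep u); symmetry; apply cls_rep. Qed.

Lemma cdist_lim (x y : CS X) :
  is_lim_seq (fun n => dist (proj1_sig x n) (proj1_sig y n)) (dist (ccls x) (ccls y)).
Proof.
  assert (E : forall x y : CS X,
    ex_finite_lim_seq (fun n => dist (proj1_sig x n) (proj1_sig y n))).
  { clear x y; intros [x Hx] [y Hy]; apply ex_lim_seq_cauchy_corr; intros eps; simpl.
    destruct (Hx (eps / 2)) as [N1 H1]; [apply is_pos_div_2 |].
    destruct (Hy (eps / 2)) as [N2 H2]; [apply is_pos_div_2 |].
    exists (max N1 N2); intros n m Hn Hm.
    specialize (H1 n m ltac:(lia) ltac:(lia)); specialize (H2 n m ltac:(lia) ltac:(lia)).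
    pose proof (dist_tri X HX (x m) (x n) (y n)); pose proof (dist_tri X HX (y m) (x m) (y n)).
    pose proof (dist_tri X HX (x n) (x m) (y m)); pose proof (dist_tri X HX (y n) (x n) (y m)).
    rewrite (dist_sym X HX (x m) (x n)), (dist_sym X HX (y m) (y n)) in *.
    apply Rabs_def1; lra. }
  set (x' := rep (cls (@ceq X) x)); set (y' := rep (cls (@ceq X) y)).
  assert (Ex : ceq x x') by (apply rep_cls, ceq_refl).
  assert (Ey : ceq y y') by (apply rep_cls, ceq_refl).
  (* [cdist] is evaluated on chosen representatives [x'] and [y']. The distances for [x] and [y] are
     squeezed around theirs, with an error that tends to 0. *)
  pose proof (Lim_seq_correct' _ (E x' y')) as L.
  pose proof (is_lim_seq_plus' _ _ _ _ Ex Ey) as S; rewrite Rplus_0_r in S.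
  pose proof (is_lim_seq_plus' _ _ _ _ L S) as U; rewrite Rplus_0_r in U.
  pose proof (is_lim_seq_minus' _ _ _ _ L S) as V; rewrite Rminus_0_r in V.
  apply is_lim_seq_le_le with (2 := V) (3 := U); intros n.
  set (a := proj1_sig x n); set (a' := proj1_sig x' n).
  set (c := proj1_sig y n); set (c' := proj1_sig y' n).
  pose proof (dist_tri X HX a' a c); pose proof (dist_tri X HX c' a' c).
  pose proof (dist_tri X HX a a' c'); pose proof (dist_tri X HX c a c').
  rewrite (dist_sym X HX a' a), (dist_sym X HX c' c) in *; lra.
Qed.

Lemma cdist_unique (x y : CS X) (l : R) :
  is_lim_seq (fun n => dist (proj1_sig x n) (proj1_sig y n)) l -> dist (ccls x) (ccls y) = l.
Proof.
  intros H; pose proof (cdist_lim x y) as K.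
  apply is_lim_seq_unique in H; apply is_lim_seq_unique in K; congruence.
Qed.

Definition cconst (x : X) : Q := ccls (exist _ (fun _ => x) (cauchy_const HX x)).

Lemma cdist_const (x y : X) : dist (cconst x) (cconst y) = dist x y.
Proof. apply cdist_unique, is_lim_seq_const. Qed.

Lemma bD_Ccomp p q : bD Q p q = bD X p q.
Proof. apply cdist_const. Qed.

Theorem squams_Ccomp : is_squams (Ccomp HX).
Proof.
  assert (le : forall (u v : nat -> R) (k l : R), (forall n, u n <= v n) ->
    is_lim_seq u k -> is_lim_seq v l -> k <= l)
    by (intros u v k l H Hu Hv; exact (is_lim_seq_le u v k l H Hu Hv)).
  split; [| split; [| split; [| split]]].
  - split; [| split; [| split]].
    + intros u v; destruct (ccls_surj u) as [x ->], (ccls_surj v) as [y ->].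
      apply le with (2 := is_lim_seq_const 0) (3 := cdist_lim x y).
      intros n; now apply dist_nonneg.
    + intros u v; destruct (ccls_surj u) as [x ->], (ccls_surj v) as [y ->]; split.
      * intros E; apply ccls_eq; unfold ceq; rewrite <- E; apply cdist_lim.
      * intros ->; apply cdist_unique, ceq_refl.
    + intros u v; destruct (ccls_surj u) as [x ->], (ccls_surj v) as [y ->].
      apply cdist_unique. apply is_lim_seq_ext with (2 := cdist_lim y x).
      intros n; now apply dist_sym.
    + intros u v w; destruct (ccls_surj u) as [x ->], (ccls_surj v) as [y ->],
        (ccls_surj w) as [z ->].
      pose proof (is_lim_seq_plus' _ _ _ _ (cdist_lim x y) (cdist_lim y z)) as K.
      apply le with (2 := cdist_lim x z) (3 := K). intros n; now apply dist_tri.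
  - intros u v; destruct (ccls_surj u) as [x ->], (ccls_surj v) as [y ->].
    apply le with (2 := cdist_lim x y) (3 := is_lim_seq_const 2).
    intros n; now apply dist_le2.
  - intros r s t u H1 H2 E.
    assert (K : bD Q (r, s) (t, u) = 0).
    { unfold bD, bnd; simpl fst; simpl snd.
      rewrite E; apply cdist_unique, ceq_refl. }
    rewrite bD_Ccomp in K. apply dist_eq in K; auto.
    apply bnd_inj in K; auto. now injection K.
  - intros i r s Hi Hr Hs. pose proof HX as [_ [_ [_ [K _]]]].
    destruct (K i r s Hi Hr Hs) as [K1 K2]; rewrite <- K1 at 1; rewrite <- K2.
    split; [apply (bD_Ccomp (i, r) (i, s)) | apply (bD_Ccomp (r, i) (s, i))].
  - intros r s t u H1 H2. pose proof HX as [_ [_ [_ [_ K]]]].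
    change (bD Q (r, s) (t, u) >= Rabs (r - t) + Rabs (s - u)).
    rewrite bD_Ccomp; now apply K.
Qed.

Lemma ccls_approx (x : CS X) eps : 0 < eps ->
  exists N, forall j, (N <= j)%nat -> dist (ccls x) (cconst (proj1_sig x j)) <= eps.
Proof.
  intros He; destruct (proj2_sig x eps He) as [N H]; exists N; intros j Hj.
  pose proof (cdist_lim x (exist _ (fun _ => proj1_sig x j) (cauchy_const HX (proj1_sig x j)))) as L.
  apply is_lim_seq_incr_n with (N := N) in L; simpl in L.
  refine (is_lim_seq_le _ _ _ _ _ L (is_lim_seq_const eps)).
  intros n; apply Rlt_le, H; lia.
Qed.

End Completion.

(** * Finality *)

Lemma infinitely_often (s : nat -> Mi) : exists m, forall N, exists k, (N <= k)%nat /\ s k = m.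
Proof.
  apply NNPP; intros H.
  assert (K : forall m, exists N, forall k, (N <= k)%nat -> s k <> m).
  { intros m; apply NNPP; intros Hm; apply H; exists m; intros N; apply NNPP; intros HN.
    apply Hm; exists N; intros k Hk E; apply HN; eauto. }
  destruct (choice _ K) as [N HN].
  (* The sum is beyond the last occurrence of every cell. *)
  set (k := (N M00 + N M01 + N M02 + N M10 + N M12 + N M20 + N M21 + N M22)%nat).
  apply (HN (s k) k); auto.
  unfold k; destruct (s _); lia.
Qed.

Lemma constant_subsequence (s : nat -> Mi) : exists m phi,
  (forall j, (phi j < phi (S j))%nat) /\ forall j, s (phi j) = m.
Proof.
  destruct (infinitely_often s) as [m H]; destruct (choice _ H) as [pick Hp].
  exists m, (fix phi j := match j with O => pick O | S j => pick (S (phi j)) end); split.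
  - intros j; simpl.
    destruct (Hp (S ((fix phi j := match j with O => pick O | S j => pick (S (phi j)) end) j))).
    lia.
  - intros [| j]; apply Hp.
Qed.

Lemma cauchy_geometric (X : SqStr) (HX : is_squams X) (x : nat -> X) (C q : R) :
  0 <= q < 1 -> 0 < C -> (forall n k, dist (x (n + k)%nat) (x n) <= C * q ^ n) -> cauchy X x.
Proof.
  intros Hq HC H eps He.
  destruct (pow_lt_eps q (eps / (2 * C)) Hq) as [N HN].
  { apply Rdiv_lt_0_compat; lra. }
  assert (L : C * q ^ N < eps / 2).
  { apply Rmult_lt_compat_l with (r := C) in HN; auto.
    replace (C * (eps / (2 * C))) with (eps / 2) in HN by (field; lra); exact HN. }
  exists N; intros n m Hn Hm.
  pose proof (H N (n - N)%nat) as H1; pose proof (H N (m - N)%nat) as H2.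
  replace (N + (n - N))%nat with n in H1 by lia.
  replace (N + (m - N))%nat with m in H2 by lia.
  pose proof (dist_tri X HX (x N) (x n) (x m)).
  rewrite (dist_sym X HX (x N) (x m)) in *; lra.
Qed.

Section Final.
Variables (G : SqStr) (HG : is_squams G) (eta : MT G -> G).
Hypothesis Hinit : is_initial_alg eta.
Variable gamma : Ccomp HG -> MT (Ccomp HG).
Hypothesis Hgamma : gamma_spec eta gamma.

Local Notation Q := (Ccomp HG).
Local Notation HQ := (squams_Ccomp G HG).

Lemma eta_morph : is_morph eta.
Proof. apply Hinit. Qed.

(** By pigeonhole some subsequence stays in one cell [m]. It represents the same class [u], so
    [gamma_spec] applies to it with the identity as [phi]. *)
Lemma gamma_data (u : Q) : exists m (x y : CS G), u = ccls G HG y /\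
  (forall j, proj1_sig y j = eta (tcls m (proj1_sig x j))) /\ gamma u = tcls m (ccls G HG x).
Proof.
  destruct (lambek G eta Hinit) as [Hsurj Hiso].
  destruct (ccls_surj G HG u) as [g ->].
  assert (V : forall k, exists a : Mi * G, proj1_sig g k = eta (tcls (fst a) (snd a))).
  { intros k; destruct (Hsurj (proj1_sig g k)) as [v ->].
    exists (rep v); now rewrite tcls_rep. }
  destruct (choice _ V) as [a Ha].
  destruct (constant_subsequence (fun k => fst (a k))) as [m [phi [Hphi Hm]]].
  assert (ge : forall j, (j <= phi j)%nat).
  { induction j; [lia |]; specialize (Hphi j); lia. }
  assert (Cy : cauchy G (fun j => proj1_sig g (phi j))).
  { intros eps He; destruct (proj2_sig g eps He) as [N HN]; exists N; intros i j Hi Hj.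
    pose proof (ge i); pose proof (ge j); apply HN; lia. }
  assert (Cx : cauchy G (fun j => snd (a (phi j)))).
  { intros eps He; destruct (Cy (eps / 3)) as [N HN]; [lra |]; exists N; intros i j Hi Hj.
    specialize (HN i j Hi Hj). rewrite !Ha, Hiso, !Hm, tdist_same_cell in HN by auto. lra. }
  set (y := exist _ _ Cy : CS G); set (x := exist _ _ Cx : CS G).
  assert (E : ccls G HG g = ccls G HG y).
  { apply ccls_eq; auto. apply is_lim_seq_spec; intros eps.
    destruct (proj2_sig g eps (cond_pos eps)) as [N HN]; exists N; intros n Hn.
    rewrite Rminus_0_r, Rabs_pos_eq by (now apply dist_nonneg).
    simpl; pose proof (ge n); apply HN; lia. }
  assert (F : forall j, proj1_sig y j = eta (tcls m (proj1_sig x j))).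
  { intros j; simpl; now rewrite Ha, Hm. }
  exists m, x, y; split; auto; split; auto.
  rewrite E; apply (Hgamma y m (fun j => j) x); auto.
Qed.

(** Since [eta] is an isometry, it remains to see that distances of the terms in [MT G] converge to
    the distance of the limits in the tensor of the completion. The two boundary metrics agree, so
    [tdist_compare] applies in both directions. *)
Lemma gamma_isometry (u v : Q) : dist (gamma u) (gamma v) = dist u v.
Proof.
  destruct (lambek G eta Hinit) as [_ Hiso].
  destruct (gamma_data u) as [m [x [y [Eu [Fy ->]]]]].
  destruct (gamma_data v) as [n [x' [y' [Ev [Fy' ->]]]]].
  rewrite Eu, Ev; symmetry; apply cdist_unique.
  apply is_lim_seq_ext with
    (fun j => dist (tcls m (proj1_sig x j)) (tcls n (proj1_sig x' j))).
  { intros j; rewrite Fy, Fy'; symmetry; apply Hiso. }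
  apply is_lim_seq_spec; intros eps.
  destruct (ccls_approx G HG x (eps / 3)) as [N HN]; [destruct eps; simpl; lra |].
  destruct (ccls_approx G HG x' (eps / 3)) as [N' HN']; [destruct eps; simpl; lra |].
  exists (max N N'); intros j Hj.
  specialize (HN j ltac:(lia)); specialize (HN' j ltac:(lia)).
  set (z := proj1_sig x j) in *; set (z' := proj1_sig x' j) in *.
  set (w := ccls G HG x) in *; set (w' := ccls G HG x') in *.
  pose proof (cond_pos eps) as He.
  assert (bD_eq : forall p q, bD Q p q = bD G p q) by exact (bD_Ccomp G HG).
  pose proof (cdist_const G HG) as CC.
  assert (S : forall a c : Q, dist a c = dist c a) by exact (dist_sym Q HQ).
  assert (T : forall a c d : Q, dist a d <= dist a c + dist c d) by (intros; apply (dist_tri Q HQ)).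
  (* Each of the two points is within [eps / 3] of its limit, whence the error [d = 2/3 * eps]; the
     factor [2/3] keeps the result below [eps]. *)
  assert (L1 : dist (tcls m z) (tcls n z') <= dist (tcls m w) (tcls n w') + 2 / 3 * (2 / 3 * eps)).
  { apply (tdist_compare Q G HQ HG); auto; try lra.
    - intros; apply Req_le; symmetry; apply bD_eq.
    - intros p Hp. rewrite <- (CC z).
      pose proof (T (cconst G HG z) w (bnd Q p)). rewrite S in HN.
      change (cconst G HG (bnd G p)) with (bnd Q p). lra.
    - intros p Hp. rewrite <- (CC _ z').
      pose proof (T (bnd Q p) w' (cconst G HG z')).
      change (cconst G HG (bnd G p)) with (bnd Q p). lra.
    - rewrite <- (CC z z').
      pose proof (T (cconst G HG z) w (cconst G HG z')).
      pose proof (T w w' (cconst G HG z')). rewrite S in HN. lra. }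
  assert (L2 : dist (tcls m w) (tcls n w') <= dist (tcls m z) (tcls n z') + 2 / 3 * (2 / 3 * eps)).
  { apply (tdist_compare G Q HG HQ); auto; try lra.
    - intros; apply Req_le; apply bD_eq.
    - intros p Hp. rewrite <- (CC z).
      pose proof (T w (cconst G HG z) (bnd Q p)).
      change (cconst G HG (bnd G p)) with (bnd Q p). lra.
    - intros p Hp. rewrite <- (CC _ z').
      pose proof (T (bnd Q p) (cconst G HG z') w'). rewrite S in HN'.
      change (cconst G HG (bnd G p)) with (bnd Q p). lra.
    - rewrite <- (CC z z').
      pose proof (T w (cconst G HG z) w').
      pose proof (T (cconst G HG z) (cconst G HG z') w'). rewrite (S w') in HN'. lra. }
  apply Rabs_def1; lra.
Qed.

Lemma gamma_morph : is_morph gamma.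
Proof.
  split.
  - intros u v; rewrite gamma_isometry; apply Rle_refl.
  - intros r s H.
    apply (Hgamma (exist _ (fun _ => sqm G r s) (cauchy_const HG (sqm G r s)))
      (cellM r s) (fun j => j)
      (exist _ (fun _ => sqm G (3 * r - INR (mx (cellM r s))) (3 * s - INR (my (cellM r s))))
        (cauchy_const HG _))); auto.
    intros j; simpl; symmetry; now apply eta_morph.
Qed.

(** * Iteration of a coalgebra *)

Section Coalgebra.
Variables (B : SqStr) (HB : is_squams B) (b : B -> MT B).
Hypothesis Hb : is_morph b.

Definition approx0 (x : B) : G :=
  epsilon (inhabits (bnd G (0, 0))) (fun y => exists p, inP p /\ x = bnd B p /\ y = bnd G p).

Fixpoint approx (n : nat) : B -> G :=
  match n with
  | O => approx0
  | S n => fun x => eta (Mmap (approx n) (b x))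
  end.

Lemma approx_fixes_boundary n : fixes_boundary (approx n).
Proof.
  induction n as [| n IH]; intros p Hp; simpl.
  - unfold approx0; match goal with |- epsilon ?i ?P = _ =>
      destruct (epsilon_spec i P) as [q [Hq [E1 E2]]] end.
    + exists (bnd G p), p; auto.
    + rewrite E2; f_equal; apply bnd_inj in E1; auto.
  - rewrite (morph_fixes_boundary _ _ _ Hb p Hp), (Mmap_fixes_boundary _ _ _ IH p Hp).
    now apply (morph_fixes_boundary _ _ _ eta_morph).
Qed.

(** The two maps are applied in the same cell, at the same representative of [b x], so each
    iteration divides their distance by 3. The initial 2 bounds the diameter. *)
Lemma approx_close n k x : dist (approx (n + k) x) (approx n x) <= 2 * (1 / 3) ^ n.
Proof.
  revert x; induction n as [| n IH]; intros x.
  - simpl pow; rewrite Rmult_1_r; now apply dist_le2.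
  - simpl; eapply Rle_trans; [apply eta_morph |].
    rewrite (Mmap_rep _ _ (approx (n + k))), (Mmap_rep _ _ (approx n)).
    eapply Rle_trans; [now apply tdist_cell |].
    specialize (IH (snd (rep (b x)))); lra.
Qed.

Lemma approx_cauchy x : cauchy G (fun n => approx n x).
Proof.
  apply (cauchy_geometric G HG _ 2 (1 / 3)); try lra; intros n k; apply approx_close.
Qed.

(** The error is at most the diameter 2 at first. Each iteration multiplies it by [2/3], thanks to
    the comparison of the boundary metrics of [G] and [B]. *)
Lemma approx_short n x y : dist (approx n x) (approx n y) <= dist x y + 2 * (2 / 3) ^ n.
Proof.
  revert x y; induction n as [| n IH]; intros x y.
  - simpl pow; pose proof (dist_le2 G HG (approx 0 x) (approx 0 y)).
    pose proof (dist_nonneg B HB x y); lra.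
  - cbn [approx]; eapply Rle_trans; [apply eta_morph |].
    assert (P : 0 <= (2 / 3) ^ n) by (apply pow_le; lra).
    eapply Rle_trans; [apply Mmap_almost_short with (d := 2 * (2 / 3) ^ n); auto; try lra |].
    + apply approx_fixes_boundary.
    + intros p q Hp Hq; apply boundary_compare; auto using bmetric_bD.
      * apply algebra_super_tensor with eta; auto using eta_morph.
      * apply coalgebra_sub_tensor with b; auto.
    + pose proof (proj1 Hb x y); simpl pow; lra.
Qed.

Definition limit (x : B) : Q := ccls G HG (exist _ _ (approx_cauchy x)).

Lemma limit_morph : is_morph limit.
Proof.
  split.
  - intros x y.
    refine (is_lim_seq_le _ _ (dist (limit x) (limit y)) (dist x y) _ (cdist_lim G HG _ _) _).
    { intros n; apply (approx_short n x y). }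
    replace (Finite (dist x y)) with (Finite (dist x y + 2 * 0)) by (f_equal; lra).
    apply is_lim_seq_plus'; [apply is_lim_seq_const |].
    apply is_lim_seq_mult'; [apply is_lim_seq_const |].
    apply is_lim_seq_geom; rewrite Rabs_pos_eq; lra.
  - intros r s H; apply ccls_eq; auto.
    apply is_lim_seq_ext with (fun _ => 0); [| apply is_lim_seq_const].
    intros n; cbn [proj1_sig].
    rewrite (approx_fixes_boundary n (r, s) H : approx n (sqm B r s) = sqm G r s).
    symmetry; now apply dist_refl.
Qed.

Lemma limit_coalgebra x : gamma (limit x) = Mmap limit (b x).
Proof.
  (* The subsequence is the shift [S]: by definition, iterate [S j] at [x] is [eta] of the cell of
     [b x] with iterate [j] inside. *)
  apply (Hgamma (exist _ _ (approx_cauchy x)) (fst (rep (b x))) S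
    (exist _ _ (approx_cauchy (snd (rep (b x)))))); auto.
Qed.

Lemma coalgebra_morph_unique (h h' : B -> Q) :
  (forall x, gamma (h x) = Mmap h (b x)) -> (forall x, gamma (h' x) = Mmap h' (b x)) ->
  forall x, h' x = h x.
Proof.
  intros E E'.
  assert (K : forall n x, dist (h' x) (h x) <= 2 * (1 / 3) ^ n).
  { induction n as [| n IH]; intros x.
    - simpl pow; rewrite Rmult_1_r; apply (dist_le2 Q HQ).
    - rewrite <- gamma_isometry, E, E'.
      rewrite (Mmap_rep _ _ h), (Mmap_rep _ _ h').
      eapply Rle_trans; [apply (tdist_cell Q HQ) |].
      specialize (IH (snd (rep (b x)))); simpl pow; lra. }
  intros x; apply (dist_eq Q HQ), Rle_antisym; [| apply (dist_nonneg Q HQ)].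
  apply le_epsilon; intros eps He.
  destruct (pow_lt_eps (1 / 3) (eps / 2) ltac:(lra) ltac:(lra)) as [n Hn].
  specialize (K n x); lra.
Qed.

End Coalgebra.
End Final.

Theorem mainTheorem2 (G : SqStr) (HG : is_squams G) (eta : MT G -> G)
  (Hinit : is_initial_alg eta)
  (gamma : Ccomp HG -> MT (Ccomp HG)) (Hgamma : gamma_spec eta gamma) :
  is_final_coalg gamma.
Proof.
  split; [apply squams_Ccomp |]; split; [eapply gamma_morph; eauto |].
  intros B HB b Hb.
  exists (limit G HG eta Hinit B b).
  split; [now apply limit_morph |]; split.
  - intros x; apply limit_coalgebra; auto.
  - intros h' _ E' x.
    apply (coalgebra_morph_unique G HG eta Hinit gamma Hgamma B b); auto.
    intros y; apply limit_coalgebra; auto.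
Qed.
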